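(* Let $M=T^{4m}$ be the torus endowed with its flat hyperk\''ahler structure $(I,J,K,g)$, let $Z=M\times S^2$ be its twistor space, and let $\mathcal P$ be the bivector field on $Z$ with $\mathcal P_{(x,\mathbf a)}=\big((s_{\mathbf a})_*P_I\big)^{(2,0)}$ (the $(2,0)$-component taken with respect to the complex structure of $Z$ at $(x,\mathbf a)$). Then $\mathcal P$, $\frac1\lambda\mathcal P$ and $\lambda\mathcal P$ are globally defined holomorphic Poisson structures on $Z$.
   Context: $T^{4m}=\mathbb R^{4m}/L$ is the quotient of $\mathbb R^{4m}$ by a lattice of translations, with the flat metric $g$ and constant complex structures $I,J,K$ orthogonal for $g$ with $IJ=-JI=K$. $P_I=\omega_I^{-1}$ is the bivector dual to the fundamental form $\omega_I(X,Y)=g(IX,Y)$: $\omega_I^{-1}(\alpha,\beta)=\beta(\omega_I^{-1}(\alpha))$, where $\omega_I^{-1}:T^*M\to TM$ is the inverse of $X\mapsto i_X\omega_I$. Twistor space: for $\mathbf a=(a,b,c)\in S^2$ put $I_{\mathbf a}=aI+bJ+cK$. On $Z=M\times S^2$ the integrable complex structure is $\mathcal I_{(x,\mathbf a)}=(I_{\mathbf a},I_{S^2})$, where $I_{S^2}$ is the canonical complex structure of $S^2\cong\mathbb{CP}^1$. The identification $S^2\cong\mathbb{CP}^1=\mathbb C\cup\{\infty\}$ is by the stereographic projection $$\lambda\mapsto\mathbf a=\left(\frac{|\lambda|^2-1}{1+|\lambda|^2},\frac{i(\overline\lambda-\lambda)}{1+|\lambda|^2},\frac{\lambda+\overline\lambda}{1+|\lambda|^2}\right),$$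 so $\lambda=\infty$ corresponds to $I$ and $\lambda=0$ to $-I$; $\lambda$ is a holomorphic coordinate on $\mathbb{CP}^1\setminus\{\infty\}$, regarded as a function on $Z$ via the projection $\pi:Z\to S^2$. For $\mathbf a\in S^2$, $s_{\mathbf a}:M\to Z$ is $s_{\mathbf a}(x)=(x,\mathbf a)$. A holomorphic Poisson structure is a holomorphic section $Q$ of $\Lambda^2T^{1,0}Z$ with vanishing Schouten bracket $[Q,Q]=0$. ''Globally defined'' for $\frac1\lambda\mathcal P$ and $\lambda\mathcal P$ means that these bivector fields, defined where $\lambda\ne0,\infty$, extend over all of $Z$. *)

(* Defs.v *)
From HB Require Import structures.
From mathcomp Require Import all_boot all_order all_algebra.
From mathcomp Require Import all_classical all_reals all_analysis.
From mathcomp.real_closed Require Import complex.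

Set Implicit Arguments.
Unset Strict Implicit.
Unset Printing Implicit Defensive.

Import Order.TTheory GRing.Theory Num.Theory.
Import numFieldNormedType.Exports.

Local Open Scope classical_set_scope.
Local Open Scope quotient_scope.
Local Open Scope ring_scope.

(* Tangent vectors are column vectors, so that the composite of endomorphisms
   A \o B is A *m B.  Covectors are row vectors.  A bivector is the matrix of
   its components Q i j = Q(dx_i, dx_j); a linear map A sends Q to
   A *m Q *m A^T. *)

Definition complexify (R : realType) (p q : nat) (A : 'M[R]_(p, q)) :
  'M[R[i]]_(p, q) := map_mx (real_complex R) A.

Section Torus.
Variables (R : realType) (n : nat) (B : 'M[R]_n).

(* The lattice spanned over the integers by the columns of B; it has full rank
   when B is invertible. *)
Definition in_lattice (v : 'cV[R]_n) : Prop :=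
  exists k : 'cV[int]_n, v = B *m map_mx intr k.

Definition lattice_rel : rel 'cV[R]_n := fun x y => `[< in_lattice (x - y) >].

Lemma lattice_rel_refl : reflexive lattice_rel.
Proof.
by move=> x; apply/asboolP; exists 0; rewrite map_mx0 mulmx0 subrr.
Qed.

Lemma lattice_rel_sym : symmetric lattice_rel.
Proof.
have H x y : in_lattice (x - y) -> in_lattice (y - x).
  by case=> k e; exists (- k); rewrite map_mxN mulmxN -e opprB.
by move=> x y; apply/asboolP/asboolP; apply: H.
Qed.

Lemma lattice_rel_trans : transitive lattice_rel.
Proof.
move=> y x z /asboolP[k e] /asboolP[l f]; apply/asboolP; exists (k + l).
by rewrite map_mxD mulmxDr -e -f addrA subrK.
Qed.

Canonical lattice_equiv :=
  EquivRel lattice_rel lattice_rel_refl lattice_rel_sym lattice_rel_trans.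

Definition torus := {eq_quot lattice_equiv}.

End Torus.

Section Sphere.
Variable R : realType.

Definition sqnorm (a : 'cV[R]_3) : R := \sum_i a i 0 ^+ 2.

Definition sphere := {a : 'cV[R]_3 | sqnorm a == 1}.

Lemma pole_subproof : sqnorm (delta_mx 0 0) == 1.
Proof.
rewrite /sqnorm (bigD1 0) //= big1 ?mxE ?eqxx ?expr1n ?addr0 // => i /negbTE h.
by rewrite mxE h expr0n.
Qed.

Definition pole : sphere := exist _ (delta_mx 0 0) pole_subproof.

(* Radial projection; the value at y = 0 is irrelevant. *)
Definition radial (y : 'cV[R]_3) : sphere :=
  insubd pole ((Num.sqrt (sqnorm y))^-1 *: y).

(* The matrix of xi |-> a x xi (indices mod 3). *)
Definition cross_mx (a : 'cV[R]_3) : 'M[R]_3 :=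
  \matrix_(i, j) (a (i + 1) 0 *+ (j == i + 2%:R)
                  - a (i + 2%:R) 0 *+ (j == i + 1)).

Definition stereographic (l : R[i]) : 'cV[R[i]]_3 :=
  \col_(k < 3) tnth [tuple (`|l| ^+ 2 - 1) / (1 + `|l| ^+ 2);
                           'i%C * (conjc l - l) / (1 + `|l| ^+ 2);
                           (l + conjc l) / (1 + `|l| ^+ 2)] k.

End Sphere.

Section FlatHyperkahler.
Variables (R : realType) (n : nat).

Definition inner_product_mx (G : 'M[R]_n) : Prop :=
  G^T = G /\ forall v : 'cV[R]_n, v != 0 -> 0 < (v^T *m G *m v) 0 0.

Definition orthogonal_complex_structure (G A : 'M[R]_n) : Prop :=
  A *m A = - 1%:M /\ A^T *m G *m A = G.

Definition hyperkahler (G I J K : 'M[R]_n) : Prop :=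
  [/\ inner_product_mx G,
      [/\ orthogonal_complex_structure G I,
          orthogonal_complex_structure G J &
          orthogonal_complex_structure G K],
      I *m J = K & J *m I = - K].

(* Entries omega(e_i, e_j) = g(A e_i, e_j). *)
Definition fundamental_form (G A : 'M[R]_n) : 'M[R]_n := A^T *m G.

(* X |-> i_X omega has matrix omega^T, and the bivector has components
   omega^-1(dx_i, dx_j) = dx_j(omega^-1(dx_i)). *)
Definition dual_bivector (omega : 'M[R]_n) : 'M[R]_n := (invmx omega^T)^T.

End FlatHyperkahler.

Section TwistorSpace.
Variables (R : realType) (n : nat) (B I J K : 'M[R]_n).

Definition twistor : Type := (torus B * sphere R)%type.

(* Z is a submanifold of (R^n / L) x R^3, and T_(x,a) Z is identified with the
   set of vectors (X, xi) of R^n x R^3 with xi orthogonal to a.  The smooth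
   structure of Z is the one for which the map R^n x (R^3 \ 0) -> Z below is a
   surjective submersion; functions on Z are differentiated after pulling them
   back by it (hence as functions constant along the rays of R^3). *)
Definition twistor_proj (e : 'cV[R]_(n + 3)) : twistor :=
  (\pi_(torus B) (usubmx e), radial (dsubmx e)).

(* A preimage of z; lattice translations are the only ambiguity, so the
   derivatives below do not depend on the chosen representative. *)
Definition twistor_lift (z : twistor) : 'cV[R]_(n + 3) :=
  col_mx (repr z.1) (val z.2).

Definition twistor_open (U : set twistor) : Prop :=
  open [set e | dsubmx e != 0 /\ U (twistor_proj e)].

Definition tangent (z : twistor) (w : 'cV[R[i]]_(n + 3)) : Prop :=
  (complexify (val z.2))^T *m dsubmx w = 0.

Definition twistor_differentiable (f : twistor -> R[i]) (z : twistor) : Prop :=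
  differentiable (fun e => complex.Re (f (twistor_proj e))) (twistor_lift z) /\
  differentiable (fun e => complex.Im (f (twistor_proj e))) (twistor_lift z).

Definition twistor_diff (f : twistor -> R[i]) (z : twistor) :
    'rV[R[i]]_(n + 3) :=
  \row_i Complex
    ('D_(delta_mx i 0) (fun e => complex.Re (f (twistor_proj e)))
       (twistor_lift z))
    ('D_(delta_mx i 0) (fun e => complex.Im (f (twistor_proj e)))
       (twistor_lift z)).

Definition I_at (a : 'cV[R]_3) : 'M[R]_n :=
  a 0 0 *: I + a 1 0 *: J + a 2%:R 0 *: K.

(* The complex structure of Z.  On the sphere xi |-> a x xi is the one for which
   the coordinate l of [stereographic] is holomorphic: at l = 0, a = (-1,0,0),
   d/dRe(l) = (0,0,2) and a x (0,0,2) = (0,2,0) = d/dIm(l). *)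
Definition twistor_cs (z : twistor) : 'M[R]_(n + 3) :=
  block_mx (I_at (val z.2)) 0 0 (cross_mx (val z.2)).

Definition T10 (z : twistor) (w : 'cV[R[i]]_(n + 3)) : Prop :=
  tangent z w /\ complexify (twistor_cs z) *m w = 'i%C *: w.

Definition holomorphic_on (U : set twistor) (f : twistor -> R[i]) : Prop :=
  forall z, U z -> twistor_differentiable f z /\
    forall w, tangent z w ->
      twistor_diff f z *m (complexify (twistor_cs z) *m w) =
      'i%C *: (twistor_diff f z *m w).

Definition holomorphic_coordinates (N : nat) (U : set twistor)
    (zeta : 'I_N -> twistor -> R[i]) : Prop :=
  [/\ twistor_open U,
      forall j, holomorphic_on U (zeta j),
      forall z z', U z -> U z' -> (forall j, zeta j z = zeta j z') -> z = z' &
      forall z w, U z -> T10 z w ->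
        (forall j, twistor_diff (zeta j) z *m w = 0) -> w = 0].

Definition bivector_field := twistor -> 'M[R[i]]_(n + 3).

Definition section_Lambda2_T10 (Q : bivector_field) : Prop :=
  forall z, (Q z)^T = - Q z /\ forall j, T10 z (col j (Q z)).

(* The coefficients Q(d zeta_i, d zeta_j) of Q in N local holomorphic
   coordinates are holomorphic; N is the complex dimension of Z. *)
Definition holomorphic_section (N : nat) (Q : bivector_field) : Prop :=
  section_Lambda2_T10 Q /\
  forall z0, exists U (zeta : 'I_N -> twistor -> R[i]),
    [/\ holomorphic_coordinates U zeta, U z0 &
        forall i j, holomorphic_on U (fun z =>
          (twistor_diff (zeta i) z *m Q z *m (twistor_diff (zeta j) z)^T) 0 0)].

(* The components of [P, Q] in the linear coordinates of R^n x R^3.  As the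
   bivectors are tangent to Z, only derivatives tangent to Z enter and the
   result is the Schouten bracket on Z. *)
Definition schouten_term (P Q : bivector_field) (z : twistor)
    (i j k : 'I_(n + 3)) : R[i] :=
  \sum_l (P z i l * twistor_diff (fun z' => Q z' j k) z 0 l
          + Q z i l * twistor_diff (fun z' => P z' j k) z 0 l).

Definition schouten (P Q : bivector_field) (z : twistor)
    (i j k : 'I_(n + 3)) : R[i] :=
  schouten_term P Q z i j k + schouten_term P Q z j k i
  + schouten_term P Q z k i j.

Definition holomorphic_poisson (N : nat) (Q : bivector_field) : Prop :=
  holomorphic_section N Q /\ forall z i j k, schouten Q Q z i j k = 0.

(* The projection of the complexified tangent space onto T10. *)
Definition proj10 (z : twistor) : 'M[R[i]]_(n + 3) :=
  2%:R^-1 *: (1%:M - 'i%C *: complexify (twistor_cs z)).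

Definition part20 (z : twistor) (Q : 'M[R]_(n + 3)) : 'M[R[i]]_(n + 3) :=
  proj10 z *m complexify Q *m (proj10 z)^T.

(* The differential of x |-> (x, a). *)
Definition section_diff : 'M[R]_(n + 3, n) := col_mx 1%:M 0.

Definition twistor_bivector (G : 'M[R]_n) : bivector_field := fun z =>
  part20 z (section_diff *m dual_bivector (fundamental_form G I)
            *m section_diff^T).

(* phi *: P, for phi a function of the coordinate l of the sphere defined for
   l <> 0, oo, is globally defined on Z as a holomorphic Poisson structure. *)
Definition extends_to_poisson (N : nat) (phi : R[i] -> R[i])
    (P : bivector_field) : Prop :=
  exists Q : bivector_field, holomorphic_poisson N Q /\
    forall (z : twistor) (l : R[i]), l != 0 ->
      complexify (val z.2) = stereographic l -> Q z = phi l *: P z.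

End TwistorSpace.

(* Main.v *)
(* Write a = (a0, a1, a2) for the point of the sphere with coordinate lambda and
   E = 1 + iI.  The quaternion relations give the factorization
     2 (1 - i I_a) = (p + qJ) E (u - vJ),  lambda = v / u,
   where (p u, p v, q u, q v) = (1 - a0, a2 + i a1, a2 - i a1, 1 + a0).  Hence
   the torus components of P are -(i/8) u v (p + qJ) X (p + qJ)^T with the
   constant X = E J G^-1 E^T: up to the factor -i/8 they are L1 X L2^T, where
   L1 = u (p + qJ) and L2 = v (p + qJ) = lambda L1 are polynomial in a, and
   L1 X L1^T, L2 X L2^T extend P / lambda and lambda P over the whole sphere.
   If the rows phi of Phi span the row space of E, then lambda (or 1 / lambda)
   and the functions phi (u - vJ) x, with (u, v) = (1, lambda) or (1 / lambda, 1),
   are holomorphic coordinates, in which the coefficients of the three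
   bivectors are constant multiples of u v, u^2 and v^2.  The Schouten brackets
   vanish because these bivectors are tangent to the torus and invariant under
   its translations. *)

Require Import Defs.
From HB Require Import structures.
From mathcomp Require Import all_boot all_order all_algebra.
From mathcomp Require Import all_classical all_reals all_analysis.
From mathcomp.real_closed Require Import complex.
From mathcomp Require Import ring lra zify.

Set Implicit Arguments.
Unset Strict Implicit.
Unset Printing Implicit Defensive.

Import Order.TTheory GRing.Theory Num.Theory.
Import numFieldNormedType.Exports.
Local Open Scope ring_scope.

Lemma near_eq_differentiable (R : numFieldType) (V W : normedModType R)
    (f g : V -> W) (x : V) :
  {near x, f =1 g} -> differentiable f x -> differentiable g x.
Proof.
move=> fg df.
have gE : g \o shift x = cst (g x) + 'd f x +o_ (0 : V) id.
  apply/eqaddoP => eps eps0.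
  have /diff_locallyP[_ /eqaddoP/(_ eps eps0)] := df.
  apply: filter_app.
  have : \forall h \near (0 : V), f (h + x) = g (h + x).
    have := near_shift (0 : V) x (fun y => f y = g y).
    by rewrite subr0 => <-.
  apply: filterS => h fgh.
  rewrite -[(f \o shift x - _) h]/(f (h + x) - (f x + 'd f x h)).
  by rewrite fgh (nbhs_singleton fg).
have dg : 'd g x = 'd f x :> (V -> W).
  by apply: diff_unique => //; case/diff_locallyP: df.
apply/diff_locallyP; rewrite dg; split=> //.
by case/diff_locallyP: df.
Qed.

Section ComplexGradient.
Variables (R : realType) (p : nat).
Implicit Types (F H : 'cV[R]_p -> R[i]) (e : 'cV[R]_p) (D : 'rV[R[i]]_p).

Definition has_gradient F e D : Prop :=
  [/\ differentiable (fun x => complex.Re (F x)) e,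
      differentiable (fun x => complex.Im (F x)) e &
      D = \row_i Complex ('D_(delta_mx i 0) (fun x => complex.Re (F x)) e)
                         ('D_(delta_mx i 0) (fun x => complex.Im (F x)) e)].

Lemma has_gradient_near F H e D :
  {near e, F =1 H} -> has_gradient F e D -> has_gradient H e D.
Proof.
move=> FH [dRe dIm ->].
have nRe : {near e, (fun x => complex.Re (F x)) =1 (fun x => complex.Re (H x))}.
  by apply: filterS FH => x ->.
have nIm : {near e, (fun x => complex.Im (F x)) =1 (fun x => complex.Im (H x))}.
  by apply: filterS FH => x ->.
split; [exact: near_eq_differentiable dRe|exact: near_eq_differentiable dIm|].
by apply/rowP => i; rewrite !mxE (near_eq_derive _ nRe) (near_eq_derive _ nIm).
Qed.

Lemma has_gradient_cst (c : R[i]) e : has_gradient (fun=> c) e 0.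
Proof.
split; try exact: differentiable_cst.
by apply/rowP => i; rewrite !mxE !derive_cst.
Qed.

Lemma has_gradientD F H e D D' : has_gradient F e D -> has_gradient H e D' ->
  has_gradient (fun x => F x + H x) e (D + D').
Proof.
move=> [FRe FIm ->] [HRe HIm ->].
have ReD : (fun x => complex.Re (F x + H x)) =
    (fun x => complex.Re (F x)) + (fun x => complex.Re (H x)).
  by apply/funext => x; rewrite raddfD.
have ImD : (fun x => complex.Im (F x + H x)) =
    (fun x => complex.Im (F x)) + (fun x => complex.Im (H x)).
  by apply/funext => x; rewrite raddfD.
split; rewrite ?ReD ?ImD; try exact: differentiableD.
by apply/rowP => i; rewrite !mxE !deriveD//; exact: diff_derivable.
Qed.

Lemma has_gradientM F H e D D' : has_gradient F e D -> has_gradient H e D' ->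
  has_gradient (fun x => F x * H x) e (F e *: D' + H e *: D).
Proof.
move=> [FRe FIm ->] [HRe HIm ->].
have ReM : (fun x => complex.Re (F x * H x)) =
    (fun x => complex.Re (F x)) * (fun x => complex.Re (H x))
    - (fun x => complex.Im (F x)) * (fun x => complex.Im (H x)).
  by apply/funext => x; rewrite !fctE; case: (F x) (H x) => [a b] [c d].
have ImM : (fun x => complex.Im (F x * H x)) =
    (fun x => complex.Re (F x)) * (fun x => complex.Im (H x))
    + (fun x => complex.Im (F x)) * (fun x => complex.Re (H x)).
  by apply/funext => x; rewrite !fctE; case: (F x) (H x) => [a b] [c d].
split; rewrite ?ReM ?ImM.
- by apply: differentiableB; apply: differentiableM.
- by apply: differentiableD; apply: differentiableM.
apply/rowP => i; rewrite !mxE.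
set a := fun x => complex.Re (F x) in FRe *.
set b := fun x => complex.Im (F x) in FIm *.
set c := fun x => complex.Re (H x) in HRe *.
set d := fun x => complex.Im (H x) in HIm *.
have derM (f g : 'cV[R]_p -> R) : differentiable f e -> differentiable g e ->
    'D_(delta_mx i 0) (f * g) e =
    f e * 'D_(delta_mx i 0) g e + g e * 'D_(delta_mx i 0) f e.
  by move=> df dg; rewrite deriveM //; exact: diff_derivable.
rewrite deriveB; [|exact/diff_derivable/differentiableM..].
rewrite deriveD; [|exact/diff_derivable/differentiableM..].
rewrite !derM // /a /b /c /d.
move: ('D_(_) _ _) => a'; move: ('D_(_) _ _) => b'.
move: ('D_(_) _ _) => c'; move: ('D_(_) _ _) => d'.
case: (F e) (H e) => [x y] [z t]; apply/eqP; rewrite eq_complex /=.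
by apply/andP; split; apply/eqP; ring.
Qed.

Lemma has_gradientZ (c : R[i]) F e D :
  has_gradient F e D -> has_gradient (fun x => c * F x) e (c *: D).
Proof.
move=> hF; have := has_gradientM (has_gradient_cst c e) hF.
by rewrite scaler0 addr0.
Qed.

Lemma has_gradient_sum (I : finType) (F : I -> 'cV[R]_p -> R[i]) e
    (D : I -> 'rV[R[i]]_p) :
  (forall i, has_gradient (F i) e (D i)) ->
  has_gradient (fun x => \sum_i F i x) e (\sum_i D i).
Proof.
move=> hF; have -> : (fun x => \sum_i F i x) = \sum_i F i.
  by apply/funext => x; rewrite fct_sumE.
elim/big_rec2 : _ => [|i D' F' _ IH]; first exact: has_gradient_cst.
exact: (has_gradientD (hF i) IH).
Qed.

Lemma has_gradient_real (g : 'cV[R]_p -> R) e : differentiable g e ->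
  has_gradient (fun x => (g x)%:C%C) e
    (\row_i ('D_(delta_mx i 0) g e)%:C%C).
Proof.
move=> dg; split => //; first exact: differentiable_cst.
by apply/rowP => i; rewrite !mxE derive_cst.
Qed.

Lemma derive_coord (i : 'I_p) e (v : 'cV[R]_p) :
  'D_v (fun x : 'cV[R]_p => x i 0) e = v i 0.
Proof.
have @f : {linear 'cV[R]_p -> R}.
  by exists (fun N : 'cV[R]_p => N i 0); do 2![eexists]; do ?[constructor];
     rewrite ?mxE// => ? *; rewrite ?mxE//; move=> ?; rewrite !mxE.
rewrite deriveE; last exact: differentiable_coord.
have -> : (fun x : 'cV[R]_p => x i 0) = f by [].
by rewrite diff_lin //; exact: coord_continuous.
Qed.

Lemma has_gradient_coord (i : 'I_p) e :
  has_gradient (fun x => (x i 0)%:C%C) e (delta_mx 0 i).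
Proof.
have -> : delta_mx 0 i =
    \row_j ('D_(delta_mx j 0) (fun x : 'cV[R]_p => x i 0) e)%:C%C.
  by apply/rowP => j; rewrite !mxE derive_coord mxE !eqxx andbT rmorph_nat eq_sym.
exact/has_gradient_real/differentiable_coord.
Qed.

Lemma has_gradient_comp (h : R -> R) (q : 'cV[R]_p -> R) e D :
  derivable h (q e) 1 -> has_gradient (fun x => (q x)%:C%C) e D ->
  has_gradient (fun x => (h (q x))%:C%C) e (('D_1 h (q e))%:C%C *: D).
Proof.
move=> /derivable1_diffP dh [/= dq _ ->].
have dhq : differentiable (h \o q) e by exact: differentiable_comp.
have -> : ('D_1 h (q e))%:C%C *: \row_i Complex ('D_(delta_mx i 0) q e)
      ('D_(delta_mx i 0) (fun=> 0) e) =
    \row_i ('D_(delta_mx i 0) (h \o q) e)%:C%C.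
  apply/rowP => i; rewrite !mxE derive_cst !deriveE //.
  have lin t : 'd h (q e) t = 'd h (q e) 1 * t.
    by rewrite -{1}(mulr1 t) [LHS]linearZ /= mulrC.
  by rewrite (diff_comp dq dh) /= -rmorphM -lin.
exact: has_gradient_real.
Qed.

End ComplexGradient.

(** * The radial projection *)

Section RadialProjection.
Variable R : realType.
Implicit Types (y : 'cV[R]_3) (a : sphere R).

Lemma sqnorm_ge0 y : 0 <= sqnorm y.
Proof. by apply: sumr_ge0 => i _; exact: sqr_ge0. Qed.

Lemma sqnorm_eq0 y : (sqnorm y == 0) = (y == 0).
Proof.
apply/eqP/eqP => [y0|->]; last first.
  by rewrite /sqnorm big1 // => i _; rewrite mxE expr0n.
apply/colP => i; rewrite mxE; apply/eqP; rewrite -sqrf_eq0.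
have /psumr_eq0P := y0; move=> -> //.
by move=> j _; exact: sqr_ge0.
Qed.

Lemma sqnormZ (c : R) y : sqnorm (c *: y) = c ^+ 2 * sqnorm y.
Proof.
by rewrite /sqnorm mulr_sumr; apply: eq_bigr => i _; rewrite mxE exprMn.
Qed.

Lemma val_radial y : y != 0 ->
  val (radial y) = (Num.sqrt (sqnorm y))^-1 *: y.
Proof.
move=> y0; rewrite /radial insubdK // unfold_in sqnormZ exprVn sqr_sqrtr.
  by rewrite mulVf // sqnorm_eq0.
exact: sqnorm_ge0.
Qed.

Lemma sqnorm_sphere a : sqnorm (val a) = 1.
Proof. exact/eqP/(valP a). Qed.

Lemma sphere_neq0 a : val a != 0.
Proof. by rewrite -sqnorm_eq0 sqnorm_sphere oner_eq0. Qed.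

Lemma radial_val a : radial (val a) = a.
Proof.
apply: val_inj; rewrite val_radial ?sphere_neq0 //.
by rewrite sqnorm_sphere sqrtr1 invr1 scale1r.
Qed.

Lemma near_dsubmx_neq0 n (e : 'cV[R]_(n + 3)) : dsubmx e != 0 ->
  \forall x \near e, dsubmx x != 0.
Proof.
move=> /cV0Pn[k]; rewrite mxE => ek.
have H := @coord_continuous R (n + 3) 1 (rshift n k) 0 e.
apply: filterS (cvgr_neq0 _ H ek) => x xk; apply/cV0Pn; exists k.
by rewrite mxE.
Qed.

Lemma has_gradient_radial_neq0 n (e : 'cV[R]_(n + 3)) (k : 'I_3) :
  dsubmx e != 0 ->
  let q := sqnorm (dsubmx e) in
  has_gradient (fun x => (val (radial (dsubmx x)) k 0)%:C%C) e
    (((Num.sqrt q)^-1)%:C%C *: delta_mx 0 (rshift n k)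
     - (e (rshift n k) 0 * (2 * q * Num.sqrt q)^-1)%:C%C *:
       \sum_(j < 3) ((dsubmx e j 0)%:C%C *: delta_mx 0 (rshift n j)
                      + (dsubmx e j 0)%:C%C *: delta_mx 0 (rshift n j))).
Proof.
move=> e0 q0.
have q0_gt0 : 0 < q0 by rewrite lt_neqAle eq_sym sqnorm_eq0 e0 sqnorm_ge0.
pose h (x : R) := (Num.sqrt x)^-1.
have [dsq Dsq] := is_derive1_sqrt q0_gt0.
have s0 : Num.sqrt q0 != 0 by rewrite gt_eqF // sqrtr_gt0.
have dh : derivable h q0 1 by exact: derivableV.
have Dh : 'D_1 h q0 = - (2 * q0 * Num.sqrt q0)^-1.
  rewrite (deriveV s0 dsq) Dsq sqr_sqrtr ?(ltW q0_gt0) //.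
  rewrite /GRing.scale /= mulNr -invfM.
  by congr (- _^-1); ring.
pose q (x : 'cV[R]_(n + 3)) := sqnorm (dsubmx x).
have hq : has_gradient (fun x => (q x)%:C%C) e
    (\sum_(j < 3) ((dsubmx e j 0)%:C%C *: delta_mx 0 (rshift n j)
       + (dsubmx e j 0)%:C%C *: delta_mx 0 (rshift n j))).
  have -> : (fun x => (q x)%:C%C) =
      (fun x => \sum_(j < 3) (x (rshift n j) 0)%:C%C * (x (rshift n j) 0)%:C%C).
    apply/funext => x; rewrite /q /sqnorm rmorph_sum; apply: eq_bigr => j _.
    by rewrite mxE -rmorphM expr2.
  apply: has_gradient_sum => j; rewrite mxE.
  by apply: has_gradientM; exact: has_gradient_coord.
have hhq := has_gradient_comp (q := q) dh hq.
have H := has_gradientM hhq (has_gradient_coord (rshift n k) e).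
have nH : {near e, (fun x => (h (q x))%:C%C * (x (rshift n k) 0)%:C%C)
    =1 (fun x => (val (radial (dsubmx x)) k 0)%:C%C)}.
  apply: filterS (near_dsubmx_neq0 e0) => x x0.
  by rewrite val_radial // -rmorphM [in RHS]mxE [dsubmx x k 0]mxE.
move: (has_gradient_near nH H); congr has_gradient.
by rewrite [q e]/q -/q0 Dh scalerA -rmorphM mulrN rmorphN scaleNr.
Qed.

Lemma has_gradient_radial n (e : 'cV[R]_(n + 3)) (k : 'I_3) :
  sqnorm (dsubmx e) = 1 ->
  has_gradient (fun x => (val (radial (dsubmx x)) k 0)%:C%C) e
    (row_mx 0 (delta_mx 0 k - (dsubmx e k 0)%:C%C *: complexify (dsubmx e)^T)).
Proof.
move=> e1; have e0 : dsubmx e != 0 by rewrite -sqnorm_eq0 e1 oner_eq0.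
have := has_gradient_radial_neq0 k e0; rewrite /= e1 sqrtr1 !mulr1 invr1.
congr has_gradient; apply/rowP => j; rewrite rmorph1 scale1r.
case: (split_ordP j) => i ->; rewrite ?row_mxEl ?row_mxEr !mxE summxE.
  rewrite eq_lrshift big1 ?mulr0 ?subr0 // => l _.
  by rewrite !mxE eq_lrshift !mulr0 addr0.
rewrite eq_rshift (bigD1 i) //= big1 => [|l /negbTE li]; last first.
  by rewrite !mxE eq_rshift [i == l]eq_sym li !mulr0 addr0.
rewrite !mxE !eqxx /= addr0 mulr1; congr (_ - _).
by rewrite -!rmorphD -!rmorphM; congr (_%:C%C); field.
Qed.

End RadialProjection.

(** * Stereographic coordinates on the sphere *)

Lemma row0_mxD (V : nmodType) m n p (X Y : 'M[V]_(m, n)) :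
  row_mx 0 X + row_mx 0 Y = row_mx 0 (X + Y) :> 'M[_]_(m, p + n).
Proof. by rewrite add_row_mx addr0. Qed.

Lemma row0_mxZ (K : pzRingType) m n p (c : K) (X : 'M[K]_(m, n)) :
  c *: row_mx 0 X = row_mx 0 (c *: X) :> 'M[_]_(m, p + n).
Proof. by rewrite scale_row_mx scaler0. Qed.

Section SphereCoordinate.
Variable R : realType.
Implicit Types (a : 'cV[R]_3) (w : 'cV[R[i]]_3) (s : R).

Lemma cross_mxE a w (i : 'I_3) : (complexify (cross_mx a) *m w) i 0 =
  (a (i + 1) 0)%:C%C * w (i + 2%:R) 0 - (a (i + 2%:R) 0)%:C%C * w (i + 1) 0.
Proof.
rewrite mxE.
have E j : complexify (cross_mx a) i j * w j 0 =
    (a (i + 1) 0)%:C%C * ((j == i + 2%:R)%:R * w j 0)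
    - (a (i + 2%:R) 0)%:C%C * ((j == i + 1)%:R * w j 0).
  rewrite !mxE rmorphB /= !rmorphMn mulrBl.
  by congr (_ - _); case: (j == _); rewrite ?mul1r ?mul0r ?mulr0.
rewrite (eq_bigr _ (fun j _ => E j)).
have pick (c : R[i]) (k : 'I_3) :
    \sum_(j < 3) c * ((j == k)%:R * w j 0) = c * w k 0.
  rewrite (bigD1 k) //= eqxx mul1r big1 ?addr0 // => j /negbTE ->.
  by rewrite mul0r mulr0.
by rewrite sumrB !pick.
Qed.

Lemma sum_ord3 (V : nmodType) (F : 'I_3 -> V) :
  \sum_i F i = F 0 + F 1 + F 2%:R.
Proof.
rewrite !big_ord_recl big_ord0 addr0 addrA.
by congr (F _ + F _ + F _); exact: val_inj.
Qed.

Definition sphere_chart s a : R[i] :=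
  Complex (a 2%:R 0) (s * a 1 0) * ((1 - s * a 0 0)^-1)%:C%C.

Lemma has_gradient_sphere_chart n (e : 'cV[R]_(n + 3)) s :
  sqnorm (dsubmx e) = 1 -> s * dsubmx e 0 0 != 1 ->
  exists D : 'rV[R[i]]_3,
    has_gradient (fun x => sphere_chart s (val (radial (dsubmx x)))) e
      (row_mx 0 D) /\
    forall w, (complexify (dsubmx e))^T *m w = 0 ->
      (D *m w) 0 0 =
        ((1 - s * dsubmx e 0 0)^-1)%:C%C * (w 2%:R 0 + 'i%C * s%:C%C * w 1 0) +
        sphere_chart s (dsubmx e) * (s / (1 - s * dsubmx e 0 0))%:C%C * w 0 0.
Proof.
move=> e1 es.
set a := dsubmx e in e1 es *.
have sa : 1 - s * a 0 0 != 0 by rewrite subr_eq0 eq_sym.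
pose l (x : R) := 1 - s * x; pose h x := (l x)^-1.
have [dl0 dl1] : is_derive (a 0 0) 1 l (- s).
  by apply: is_derive_eq; rewrite /= /GRing.scale /=; ring.
have dh : derivable h (a 0 0) 1 by apply: (@derivableV _ _ l).
have Dh : 'D_1 h (a 0 0) = s * (1 - s * a 0 0) ^- 2.
  rewrite (@deriveV _ _ l); [|exact: sa|exact: dl0].
  by rewrite dl1 /GRing.scale /= mulrNN mulrC.
pose G (k : 'I_3) : 'rV[R[i]]_3 := delta_mx 0 k - (a k 0)%:C%C *: complexify a^T.
have hG k : has_gradient (fun x => (val (radial (dsubmx x)) k 0)%:C%C) e
    (row_mx 0 (G k)) by exact: has_gradient_radial.
have erad : val (radial a) = a.
  by rewrite val_radial -?sqnorm_eq0 e1 ?oner_eq0 // sqrtr1 invr1 scale1r.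
have := has_gradient_comp (h := h) _ (hG 0); rewrite erad => /(_ dh) hh.
have hA := has_gradientD (hG 2%:R) (has_gradientZ ('i%C * s%:C%C) (hG 1)).
have := has_gradientM hA hh; rewrite erad Dh.
have AE (y : 'cV[R]_3) : (y 2%:R 0)%:C%C + 'i%C * s%:C%C * (y 1 0)%:C%C =
    Complex (y 2%:R 0) (s * y 1 0).
  by apply/eqP; rewrite eq_complex /=; apply/andP; split; apply/eqP; ring.
rewrite AE; set A := Complex (a _ _) _.
set c := (_ / _)%:C%C; set g := (h _)%:C%C => H.
exists (A *: (c *: G 0) + g *: (G 2%:R + ('i%C * s%:C%C) *: G 1)); split.
  have -> : (fun x : 'cV[R]_(n + 3) =>
      sphere_chart s (val (radial (dsubmx x)))) =
      (fun x => ((val (radial (dsubmx x)) 2%:R 0)%:C%C +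
      'i%C * s%:C%C * (val (radial (dsubmx x)) 1 0)%:C%C) *
      (h (val (radial (dsubmx x)) 0 0))%:C%C).
    by apply/funext => x; rewrite AE.
  move: H; congr has_gradient.
  by rewrite !(row0_mxZ, row0_mxD).
move=> w; rewrite /complexify matrix.map_trmx => aw.
have Gw k : (G k *m w) 0 0 = w k 0.
  rewrite mulmxBl -scalemxAl aw scaler0 subr0.
  rewrite mxE (bigD1 k) //= mxE !eqxx mul1r big1 ?addr0 // => j jk.
  by rewrite mxE (negbTE jk) mul0r.
clearbody G; rewrite !mulmxDl -!scalemxAl !mulmxDl -!scalemxAl.
have mE (M M' : 'M[R[i]]_1) (x : R[i]) : (M + M') 0 0 = M 0 0 + M' 0 0
    /\ (x *: M) 0 0 = x * M 0 0 by rewrite !mxE.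
have mD M M' := (mE M M' 0).1; have mZ x M := (mE M M x).2.
rewrite !(mD, mZ) !Gw /sphere_chart -/A -/g.
have -> : A * g * (s / (1 - s * a 0 0))%:C%C * w 0 0 = A * (c * w 0 0).
  rewrite -!mulrA; congr (A * _); rewrite mulrA; congr (_ * _).
  by rewrite /g /c -rmorphM; congr (_%:C%C); rewrite /h /l; field.
by rewrite addrC.
Qed.

End SphereCoordinate.

Section ChartAlgebra.
Variables (F : numFieldType) (i s a0 a1 a2 g w0 w1 w2 : F).
Hypotheses (hi : i * i = -1) (hs : s * s = 1).
Hypothesis (ha : a0 * a0 + a1 * a1 + a2 * a2 = 1).
Hypothesis (hw : a0 * w0 + a1 * w1 + a2 * w2 = 0).
Hypothesis (hg : g * (1 - s * a0) = 1).

Let A := a2 + i * s * a1.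
Let x0 := a1 * w2 - a2 * w1.
Let x1 := a2 * w0 - a0 * w2.
Let x2 := a0 * w1 - a1 * w0.

Lemma chart_derivative_holomorphic :
  g * (x2 + i * s * x1) + A * g * (s * g) * x0 =
  i * (g * (w2 + i * s * w1) + A * g * (s * g) * w0).
Proof.
have E : (1 - s * a0) * (x2 + i * s * x1) + A * s * x0 =
    i * ((1 - s * a0) * (w2 + i * s * w1) + A * s * w0).
  transitivity (i * ((1 - s * a0) * (w2 + i * s * w1) + A * s * w0)
      + (1 - (a0 * a0 + a1 * a1 + a2 * a2)) * (s * w1 - i * w2)
      - i * A * (a0 * w0 + a1 * w1 + a2 * w2)).
    by rewrite /x0 /x1 /x2 /A; ring: hi hs.
  by rewrite ha hw; ring.
have gE y y' : g * y + A * g * (s * g) * y' =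
    g * g * ((1 - s * a0) * y + A * s * y').
  by rewrite -{1}(mulr1 g) -{1}hg; ring.
by rewrite !gE E; ring.
Qed.

Lemma chart_derivative_inj :
  x0 = i * w0 -> x1 = i * w1 -> x2 = i * w2 ->
  g * (w2 + i * s * w1) + A * g * (s * g) * w0 = 0 ->
  [/\ w0 = 0, w1 = 0 & w2 = 0].
Proof.
move=> h0 h1 h2 hD.
have g0 : g != 0 by apply: contra_eq_neq hg => ->; rewrite mul0r eq_sym oner_eq0.
have p0 : 1 - s * a0 != 0.
  by apply: contra_eq_neq hg => ->; rewrite mulr0 eq_sym oner_eq0.
have i0 : i != 0.
  by apply: contra_eq_neq hi => ->; rewrite mulr0 eq_sym oppr_eq0 oner_eq0.
have s0 : s != 0.
  by apply: contra_eq_neq hs => ->; rewrite mulr0 eq_sym oner_eq0.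
have E1 : (1 - s * a0) * (w2 + i * s * w1) + A * s * w0 = 0.
  apply: (mulfI g0); apply: (mulfI g0); rewrite !mulr0 -hD.
  by rewrite -{3}(mulr1 g) -{2}hg; ring.
have e1 : w1 = - i * x1 by rewrite h1; ring: hi.
have e2 : w2 = - i * x2 by rewrite h2; ring: hi.
have E2 : (1 + s * a0) * (w2 + i * s * w1) - A * s * w0 = 0.
  rewrite mulrDl mul1r {1}e1 {1}e2 /x1 /x2 /A; ring: hi hs.
have E3 : w2 + i * s * w1 = 0.
  apply: (@mulfI _ 2); first by rewrite pnatr_eq0.
  by rewrite mulr0 -[RHS]addr0 -{1}E1 -E2; ring.
have Aw0 : A * w0 = 0.
  by apply: (mulfI s0); rewrite mulr0 -[RHS]E1 E3; ring.
have w00 : w0 = 0.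
  apply/eqP/negP => /negP w0n.
  have A0 : A = 0 by apply: (mulIf w0n); rewrite mul0r.
  have w2E : w2 = - i * s * w1.
    by apply/eqP; rewrite -subr_eq0 -E3; apply/eqP; ring.
  have : a0 * w0 = i * s * A * w1.
    apply/eqP; rewrite -subr_eq0 -[X in _ == X]hw w2E /A; apply/eqP.
    ring: hi hs.
  rewrite A0 mulr0 mul0r => /eqP; rewrite mulf_eq0 (negbTE w0n) orbF => /eqP a00.
  have a2E : a2 = - i * s * a1.
    by apply/eqP; rewrite -subr_eq0 -A0 /A; apply/eqP; ring.
  move: ha; rewrite a00 a2E => /eqP; apply/negP.
  have -> : 0 * 0 + a1 * a1 + - i * s * a1 * (- i * s * a1) = 0.
    ring: hi hs.
  by rewrite eq_sym oner_eq0.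
have E4 : (1 - s * a0) * (w2 - i * s * w1) = 0.
  rewrite mulrBl mul1r {1}e1 {1}e2 /x1 /x2 w00; ring: hi hs.
have E5 : w2 - i * s * w1 = 0 by apply: (mulfI p0); rewrite mulr0.
have w20 : w2 = 0.
  apply: (@mulfI _ 2); first by rewrite pnatr_eq0.
  by rewrite mulr0 -[RHS]addr0 -{1}E3 -E5; ring.
split => //; apply: (mulfI s0); apply: (mulfI i0).
by rewrite !mulr0 -[RHS]E3 w20; ring.
Qed.

End ChartAlgebra.

Section HomogeneousChart.
Variable R : realType.
Implicit Types (a : 'cV[R]_3) (b : bool).

(* The coordinate lambda when b holds, and 1 / lambda otherwise; in both cases
   lambda is chart_v b / chart_u b. *)
Definition chart_sign b : R := if b then 1 else -1.
Definition chart_t b a : R[i] := sphere_chart (chart_sign b) a.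
Definition chart_u b a : R[i] := if b then 1 else chart_t b a.
Definition chart_v b a : R[i] := if b then chart_t b a else 1.
Definition chart_dom b a : Prop := chart_sign b * a 0 0 != 1.

Lemma chart_sign_sqr b : chart_sign b * chart_sign b = 1.
Proof. by case: b; rewrite /chart_sign ?mulrNN mulr1. Qed.

Lemma sqnorm_eq1 a : sqnorm a = 1 ->
  a 0 0 * a 0 0 + a 1 0 * a 1 0 + a 2%:R 0 * a 2%:R 0 = 1.
Proof. by move<-; rewrite /sqnorm sum_ord3 !expr2. Qed.

Lemma chart_domT a : exists b, chart_dom b a.
Proof.
have [a1|a1] := eqVneq (a 0 0) 1; last first.
  by exists true; rewrite /chart_dom mul1r.
exists false; rewrite /chart_dom a1 mulr1 -subr_eq0 -opprD oppr_eq0.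
by rewrite -[1 + 1](natrD _ 1 1) pnatr_eq0.
Qed.

Definition hopf_p b a : R[i] :=
  if b then (1 - a 0 0)%:C%C else Complex (a 2%:R 0) (a 1 0).
Definition hopf_q b a : R[i] :=
  if b then Complex (a 2%:R 0) (- a 1 0) else (1 + a 0 0)%:C%C.

Lemma hopf_chart b a : sqnorm a = 1 -> chart_dom b a ->
  [/\ hopf_p b a * chart_u b a = (1 - a 0 0)%:C%C,
      hopf_p b a * chart_v b a = Complex (a 2%:R 0) (a 1 0),
      hopf_q b a * chart_u b a = Complex (a 2%:R 0) (- a 1 0) &
      hopf_q b a * chart_v b a = (1 + a 0 0)%:C%C].
Proof.
move=> /sqnorm_eq1 e1; rewrite /chart_dom => sa.
have {}sa : 1 - chart_sign b * a 0 0 != 0 by rewrite subr_eq0 eq_sym.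
have e2 : a 1 0 * a 1 0 = 1 - a 0 0 * a 0 0 - a 2%:R 0 * a 2%:R 0.
  by rewrite -e1; ring.
rewrite /chart_u /chart_v /chart_t /sphere_chart /hopf_p /hopf_q.
case: b sa => /= sa; rewrite /chart_sign ?mulN1r ?mul1r in sa *; split.
all: apply/eqP; rewrite eq_complex /=; apply/andP; split; apply/eqP.
all: try ring; try (by field; exact: sa); try (by field: e2; exact: sa).
Qed.

Lemma chart_t_inj b a a' : sqnorm a = 1 -> sqnorm a' = 1 ->
  chart_dom b a -> chart_dom b a' -> chart_t b a = chart_t b a' -> a = a'.
Proof.
rewrite /chart_dom /chart_t /sphere_chart.
move=> /sqnorm_eq1 e1 /sqnorm_eq1 e2; have := chart_sign_sqr b.
move: (chart_sign b) => s ss sa sa'.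
have {}sa : 1 - s * a 0 0 != 0 by rewrite subr_eq0 eq_sym.
have {}sa' : 1 - s * a' 0 0 != 0 by rewrite subr_eq0 eq_sym.
move=> /eqP; rewrite eq_complex /= !mulr0 !subr0 !add0r => /andP[/eqP h2 /eqP h1].
have f2 : a 2%:R 0 * (1 - s * a' 0 0) = a' 2%:R 0 * (1 - s * a 0 0).
  apply: (canLR (divfK sa')); rewrite mulrAC -h2 -mulrA mulVf ?mulr1 //.
have f1 : a 1 0 * (1 - s * a' 0 0) = a' 1 0 * (1 - s * a 0 0).
  apply: (canLR (divfK sa')); rewrite mulrAC.
  transitivity (s * (s * a' 1 0 / (1 - s * a' 0 0)) * (1 - s * a 0 0)).
    by rewrite -h1 !mulrA ss mul1r -!mulrA mulVf ?mulr1.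
  by rewrite !mulrA ss mul1r.
set x := a 0 0 in e1 sa h1 h2 f1 f2 *.
set y := a' 0 0 in e2 sa' h1 h2 f1 f2 *.
have g1 : (1 - s * x) * (1 + s * x) = a 1 0 * a 1 0 + a 2%:R 0 * a 2%:R 0.
  by transitivity (1 - (s * s) * (x * x)); [ring|rewrite ss mul1r -{1}e1; ring].
have g2 : (1 - s * y) * (1 + s * y) = a' 1 0 * a' 1 0 + a' 2%:R 0 * a' 2%:R 0.
  by transitivity (1 - (s * s) * (y * y)); [ring|rewrite ss mul1r -{1}e2; ring].
have f3 : (1 + s * x) * (1 - s * y) = (1 + s * y) * (1 - s * x).
  apply: (mulfI sa); apply: (mulfI sa').
  transitivity ((1 - s * x) * (1 + s * x) * (1 - s * y) * (1 - s * y)).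
    by ring.
  transitivity ((1 - s * y) * (1 + s * y) * (1 - s * x) * (1 - s * x)).
    rewrite g1 g2 !mulrDl.
    congr (_ + _).
      transitivity ((a 1 0 * (1 - s * y)) * (a 1 0 * (1 - s * y))); first by ring.
      by rewrite f1; ring.
    transitivity ((a 2%:R 0 * (1 - s * y)) * (a 2%:R 0 * (1 - s * y))).
      by ring.
    by rewrite f2; ring.
  by ring.
have xy : x = y.
  have : s * ((1 + s * x) * (1 - s * y) - (1 + s * y) * (1 - s * x)) = 0.
    by rewrite f3 subrr mulr0.
  move=> E; apply/eqP; rewrite -subr_eq0.
  have : 2 * (x - y) == 0.
    rewrite -E; apply/eqP.
    transitivity (s * s * (2 * (x - y))); [by rewrite ss mul1r|ring].
  by rewrite mulf_eq0 pnatr_eq0.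
rewrite xy in f1 f2; apply/colP => k.
have {}f1 : a 1 0 = a' 1 0 by apply: (mulIf sa').
have {}f2 : a 2%:R 0 = a' 2%:R 0 by apply: (mulIf sa').
case: k => [[|[|[|//]]] kP].
- by rewrite (_ : Ordinal _ = 0) //; exact: val_inj.
- by rewrite (_ : Ordinal _ = 1) //; exact: val_inj.
- by rewrite (_ : Ordinal _ = 2%:R) //; exact: val_inj.
Qed.

End HomogeneousChart.

(** * Quaternions acting on the tangent space *)

Section Quaternions.
Variables (F : numFieldType) (n : nat) (I J K Gi : 'M[F]_n).
Hypotheses (hII : I *m I = - 1%:M) (hJJ : J *m J = - 1%:M).
Hypotheses (hIJ : I *m J = K) (hJI : J *m I = - K).
Hypotheses (hGI : Gi *m I^T = - (I *m Gi)) (hGJ : Gi *m J^T = - (J *m Gi)).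
Hypothesis hGT : Gi^T = Gi.

Definition quat (x0 x1 x2 x3 : F) : 'M[F]_n :=
  x0%:M + x1 *: I + x2 *: J + x3 *: K.

Lemma quat_scale c x0 x1 x2 x3 :
  c *: quat x0 x1 x2 x3 = quat (c * x0) (c * x1) (c * x2) (c * x3).
Proof. by rewrite /quat !scalerDr scale_scalar_mx !scalerA. Qed.

Lemma quatN x0 x1 x2 x3 :
  - quat x0 x1 x2 x3 = quat (- x0) (- x1) (- x2) (- x3).
Proof. by rewrite -scaleN1r quat_scale !mulN1r. Qed.

Lemma quatD x0 x1 x2 x3 y0 y1 y2 y3 :
  quat x0 x1 x2 x3 + quat y0 y1 y2 y3 =
  quat (x0 + y0) (x1 + y1) (x2 + y2) (x3 + y3).
Proof.
apply/matrixP => r c; rewrite !mxE.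
move: (I r c) (J r c) (K r c) => ? ? ?.
by case: (r == c); rewrite ?mulr1n ?mulr0n; ring.
Qed.

Lemma quat1 : quat 1 0 0 0 = 1%:M.
Proof. by rewrite /quat !scale0r !addr0. Qed.

Lemma quatI : quat 0 1 0 0 = I.
Proof. by rewrite /quat !scale0r !addr0 scale1r raddf0 add0r. Qed.

Lemma quatJ : quat 0 0 1 0 = J.
Proof. by rewrite /quat !scale0r !addr0 scale1r raddf0 add0r. Qed.

Lemma quatM x0 x1 x2 x3 y0 y1 y2 y3 :
  quat x0 x1 x2 x3 *m quat y0 y1 y2 y3 =
  quat (x0 * y0 - x1 * y1 - x2 * y2 - x3 * y3)
       (x0 * y1 + x1 * y0 + x2 * y3 - x3 * y2)
       (x0 * y2 - x1 * y3 + x2 * y0 + x3 * y1)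
       (x0 * y3 + x1 * y2 - x2 * y1 + x3 * y0).
Proof.
have hIK : I *m K = - J by rewrite -hIJ mulmxA hII mulNmx mul1mx.
have hKJ : K *m J = - I by rewrite -hIJ -mulmxA hJJ mulmxN mulmx1.
have hKI : K *m I = J by rewrite -hIJ -mulmxA hJI mulmxN hIK opprK.
have hJK : J *m K = I by rewrite -hIJ mulmxA hJI mulNmx hKJ opprK.
have hKK : K *m K = - 1%:M by rewrite -{1}hIJ -mulmxA hJK.
rewrite /quat !mulmxDl !mulmxDr -!scalemxAl -!scalemxAr.
rewrite !mul_scalar_mx !mul_mx_scalar ?scale_scalar_mx.
rewrite hII hJJ hKK hIJ hJI hIK hKI hJK hKJ.
apply/matrixP => r c; rewrite !mxE.
move: (I r c) (J r c) (K r c) => ? ? ?; case: (r == c); rewrite ?mulr1n ?mulr0n; ring.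
Qed.

Lemma quat_metric x0 x1 x2 x3 :
  Gi *m (quat x0 x1 x2 x3)^T = quat x0 (- x1) (- x2) (- x3) *m Gi.
Proof.
have hGK : Gi *m K^T = - (K *m Gi).
  rewrite -{1}hIJ trmx_mul mulmxA hGJ mulNmx -mulmxA hGI mulmxN opprK mulmxA hJI.
  by rewrite mulNmx.
have tr (X : 'M[F]_n) c : (c *: X)^T = c *: X^T by rewrite linearZ.
have trD (X Y : 'M[F]_n) : (X + Y)^T = X^T + Y^T by rewrite linearD.
rewrite /quat !trD !tr tr_scalar_mx !mulmxDr !mulmxDl -!scalemxAr.
rewrite hGI hGJ hGK -!scalemxAl mul_mx_scalar mul_scalar_mx.
by rewrite !scalerN !scaleNr.
Qed.

Section Factorization.
Variable i : F.
Hypothesis hi : i * i = -1.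

Let E := quat 1 i 0 0.

Definition plane (p q : F) : 'M[F]_n := quat p 0 q 0.

Definition plane_bivector (p q p' q' : F) : 'M[F]_n :=
  (- i / 8) *: (plane p q *m E *m J *m Gi *m E^T *m (plane p' q')^T).

Lemma plane_bivectorE p q p' q' : plane_bivector p q p' q' =
  quat (- i / 4 * (p * q' - q * p')) ((p * q' + q * p') / 4)
       (- i / 4 * (p * p' + q * q')) ((p * p' - q * q') / 4) *m Gi.
Proof.
have ET (X : 'M[F]_n) : X *m Gi *m E^T = X *m quat 1 (- i) 0 0 *m Gi.
  by rewrite -mulmxA quat_metric !oppr0 mulmxA.
have PT (X : 'M[F]_n) :
    X *m Gi *m (plane p' q')^T = X *m quat p' 0 (- q') 0 *m Gi.
  by rewrite -mulmxA quat_metric !oppr0 mulmxA.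
rewrite /plane_bivector ET PT scalemxAl; congr (_ *m _).
have -> : plane p q *m E *m J *m quat 1 (- i) 0 0 =
    quat (- 2 * q) (2 * i * q) (2 * p) (2 * i * p).
  by rewrite -[J in LHS]quatJ /plane /E !quatM; congr quat; ring: hi.
by rewrite quatM quat_scale; congr quat; field: hi.
Qed.

Lemma plane_bivector_skew p q p' q' : p * q' = q * p' ->
  (plane_bivector p q p' q')^T = - plane_bivector p q p' q'.
Proof.
move=> pq; rewrite plane_bivectorE pq subrr mulr0 trmx_mul hGT quat_metric.
by rewrite -mulNmx quatN; congr (_ *m _); congr quat; ring.
Qed.

Lemma plane_bivectorZ g h p q p' q' :
  plane_bivector (g * p) (g * q) (h * p') (h * q') =
  (g * h) *: plane_bivector p q p' q'.
Proof.
have pZ c x y : plane (c * x) (c * y) = c *: plane x y.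
  by rewrite /plane quat_scale !mulr0.
rewrite /plane_bivector !pZ linearZ /= -!scalemxAl -scalemxAr !scalerA.
by congr (_ *: _); ring.
Qed.

Lemma coframe_exists m : n = (4 * m)%N ->
  exists (Phi : 'M[F]_(2 * m, n)) (C : 'M[F]_(n, 2 * m)),
    Phi *m I = - i *: Phi /\ E = C *m Phi.
Proof.
move=> nE.
pose E' := quat 1 (- i) 0 0.
have JE : E' *m J = J *m E.
  by rewrite -[J in E' *m J]quatJ -[J in J *m E]quatJ /E' /E !quatM; congr quat; ring.
have Ju : J \in unitmx.
  have /mulmx1_unit[] : J *m - J = 1%:M by rewrite mulmxN hJJ opprK.
  by [].
(* J exchanges 1 + iI and 1 - iI, so both have rank n / 2. *)
have rE' : \rank E' = \rank E.
  have <- : \rank (E' *m J) = \rank E'.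
    by rewrite mxrankMfree // row_free_unit.
  by rewrite JE (eqmxMfull E (A := J)) ?row_full_unit.
have EE' : E *m E' = 0.
  rewrite /E /E' !quatM -(scale0r (quat 1 0 0 0)) quat_scale; congr quat; ring: hi.
have rE : \rank E = (2 * m)%N.
  have := mulmx0_rank_max EE'; have := mxrank_add E E'.
  have -> : E + E' = 2%:M.
    by rewrite quatD -scalemx1 -quat1 quat_scale; congr quat; ring.
  rewrite (_ : \rank (2%:M : 'M[F]_n) = n); last first.
    by apply: mxrank_unit; rewrite unitmxE det_scalar unitrX // unitfE pnatr_eq0.
  rewrite rE'; lia.
have EI : E *m I = - i *: E.
  by rewrite -[I in LHS]quatI /E quatM quat_scale; congr quat; ring: hi.
have [Phi [C [PhiE EC]]] : exists (Phi : 'M[F]_(\rank E, n)) (C : 'M[F]_(n, \rank E)),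
    Phi *m I = - i *: Phi /\ E = C *m Phi.
  exists (row_base E), (col_base E); split; last by rewrite mulmx_base.
  have /submxP[X ->] : (row_base E <= E)%MS by rewrite eq_row_base.
  by rewrite -mulmxA EI -scalemxAr.
by rewrite rE in Phi C PhiE EC *; exists Phi, C.
Qed.

Variables (a0 a1 a2 : F).
Hypothesis ha : a0 * a0 + a1 * a1 + a2 * a2 = 1.

Let S := quat 0 a0 a1 a2.

Lemma plane_bivector_type p q p' q' :
  S *m (plane p q *m E) = i *: (plane p q *m E) ->
  S *m plane_bivector p q p' q' = i *: plane_bivector p q p' q'.
Proof.
move=> SE; rewrite /plane_bivector -scalemxAr [RHS]scalerA (mulrC i) -[in RHS]scalerA.
congr (_ *: _).
by rewrite !mulmxA -(mulmxA S) SE -!scalemxAl.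
Qed.

Lemma plane_type_S : S *m (plane (1 - a0) (a2 - i * a1) *m E) =
  i *: (plane (1 - a0) (a2 - i * a1) *m E).
Proof.
have ha' : a0 * a0 = 1 - a1 * a1 - a2 * a2 by rewrite -ha; ring.
rewrite /plane /E /S !quatM quat_scale; congr quat; ring: hi ha'.
Qed.

Lemma plane_type_N : S *m (plane (a2 + i * a1) (1 + a0) *m E) =
  i *: (plane (a2 + i * a1) (1 + a0) *m E).
Proof.
have ha' : a0 * a0 = 1 - a1 * a1 - a2 * a2 by rewrite -ha; ring.
rewrite /plane /E /S !quatM quat_scale; congr quat; ring: hi ha'.
Qed.

Lemma one_minus_iS : 1%:M - i *: S = quat 1 (- i * a0) (- i * a1) (- i * a2).
Proof. by rewrite -quat1 /S quat_scale quatN quatD; congr quat; ring. Qed.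

Lemma part20_plane_bivector :
  (2^-1 *: (1%:M - i *: S)) *m (I *m Gi) *m (2^-1 *: (1%:M - i *: S))^T =
  plane_bivector (1 - a0) (a2 - i * a1) (a2 + i * a1) (1 + a0).
Proof.
have ha' : a0 * a0 = 1 - a1 * a1 - a2 * a2 by rewrite -ha; ring.
rewrite one_minus_iS.
set Y := quat _ _ _ _; have -> : (2^-1 *: Y)^T = 2^-1 *: Y^T by rewrite linearZ.
rewrite -!scalemxAl -scalemxAr -mulmxA -[I *m Gi *m _]mulmxA quat_metric !mulmxA.
rewrite plane_bivectorE scalerA.
have -> : Y *m I *m quat 1 (- (- i * a0)) (- (- i * a1)) (- (- i * a2)) =
    quat 0 (2 * a1 * a1 + 2 * a2 * a2) (- 2 * a0 * a1 - 2 * i * a2)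
      (- 2 * a0 * a2 + 2 * i * a1).
  by rewrite -[I in LHS]quatI !quatM; congr quat; ring: hi ha'.
rewrite scalemxAl quat_scale; congr (_ *m _).
by congr quat; field: hi ha'.
Qed.

Section Point.
Variables p q u v : F.
Hypotheses (hpu : p * u = 1 - a0) (hpv : p * v = a2 + i * a1).
Hypotheses (hqu : q * u = a2 - i * a1) (hqv : q * v = 1 + a0).

Lemma hopf_factorization :
  plane p q *m E *m plane u (- v) = 2 *: (1%:M - i *: S).
Proof.
rewrite one_minus_iS quat_scale.
transitivity (quat (p * u + q * v) (i * (p * u - q * v))
  (q * u - p * v) (- i * (p * v + q * u))).
  by rewrite /plane /E !quatM; congr quat; ring.
by rewrite hpu hpv hqu hqv; congr quat; ring: hi.
Qed.

Lemma hopf_factorization_rev :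
  E *m plane u (- v) *m (plane p q *m E) = 4 *: E.
Proof.
rewrite mulmxA -[E *m _ *m _]mulmxA.
have -> : plane u (- v) *m plane p q = quat 2 0 (- 2 * i * a1) 0.
  rewrite /plane quatM; congr quat; try ring.
    by transitivity (p * u + q * v); [ring|rewrite hpu hqv; ring].
  by transitivity (q * u - p * v); [ring|rewrite hpv hqu; ring].
by rewrite /E !quatM quat_scale; congr quat; ring: hi.
Qed.

Lemma type10_factor k (Phi : 'M[F]_(k, n)) :
  Phi *m I = - i *: Phi -> Phi *m E = 2 *: Phi.
Proof.
move=> PI; have -> : E = 1%:M + i *: I by rewrite /E /quat !scale0r !addr0.
rewrite mulmxDr mulmx1 -scalemxAr PI scalerA mulrN hi opprK scale1r.
by rewrite scaler_nat mulr2n.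
Qed.

Lemma coframe_pairing k (Phi : 'M[F]_(k, n)) : Phi *m I = - i *: Phi ->
  Phi *m plane u (- v) *m (plane p q *m E) = 4 *: Phi.
Proof.
move=> /type10_factor PE; have two0 : (2 : F) != 0 by rewrite pnatr_eq0.
apply: (scalerI two0); rewrite !scalemxAl -PE -!(mulmxA Phi).
by rewrite hopf_factorization_rev -scalemxAr PE scalerA scalerA mulrC.
Qed.

Lemma coframe_type k (Phi : 'M[F]_(k, n)) : Phi *m I = - i *: Phi ->
  Phi *m plane u (- v) *m S = i *: (Phi *m plane u (- v)).
Proof.
move=> /coframe_pairing; set X := Phi *m _ => PM.
have two0 : (2 : F) != 0 by rewrite pnatr_eq0.
have H : X *m (1%:M - i *: S) = 2 *: X.
  apply: (scalerI two0); rewrite scalemxAr -hopf_factorization !mulmxA.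
  rewrite -[X *m _ *m E]mulmxA PM -scalemxAl scalerA; congr (_ *: _); ring.
have iXS : i *: (X *m S) = - X.
  apply: oppr_inj; rewrite opprK; apply: (addrI X).
  by rewrite -[RHS]mulr2n -scaler_nat -H mulmxBr mulmx1 -scalemxAr.
transitivity (- ((i * i) *: (X *m S))); first by rewrite hi scaleN1r opprK.
by rewrite -scalerA iXS scalerN opprK.
Qed.

Lemma coframe_inj k l (Phi : 'M[F]_(k, n)) (C : 'M[F]_(n, k)) (w : 'M[F]_(n, l)) :
  E = C *m Phi -> Phi *m plane u (- v) *m w = 0 -> w = i *: (S *m w).
Proof.
move=> EC Pw; have two0 : (2 : F) != 0 by rewrite pnatr_eq0.
have : 2 *: (1%:M - i *: S) *m w = 0.
  rewrite -hopf_factorization EC !mulmxA -!mulmxA.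
  by move: Pw; rewrite -!mulmxA => ->; rewrite !mulmx0.
rewrite -scalemxAl => /eqP; rewrite scaler_eq0 (negbTE two0) /= => /eqP.
by rewrite mulmxBl mul1mx -scalemxAl => /eqP; rewrite subr_eq0 => /eqP.
Qed.

Lemma coframe_bivector k (Phi : 'M[F]_(k, n)) : Phi *m I = - i *: Phi ->
  Phi *m plane u (- v) *m plane_bivector p q p q *m (Phi *m plane u (- v))^T =
  (- 2 * i) *: (Phi *m J *m Gi *m Phi^T).
Proof.
move=> /coframe_pairing PM; rewrite /plane_bivector -scalemxAr -scalemxAl.
have -> : Phi *m plane u (- v) *m (plane p q *m E *m J *m Gi *m E^T
      *m (plane p q)^T) *m (Phi *m plane u (- v))^T =
    (Phi *m plane u (- v) *m (plane p q *m E)) *m J *m Gi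
    *m (Phi *m plane u (- v) *m (plane p q *m E))^T.
  by rewrite !trmx_mul !mulmxA.
rewrite PM; have -> : (4 *: Phi)^T = 4 *: Phi^T by rewrite linearZ.
by rewrite -scalemxAr -!scalemxAl !scalerA; congr (_ *: _); field.
Qed.

End Point.

End Factorization.

End Quaternions.

(** * Local sections of the torus *)

Section TorusSection.
Variables (R : realType) (n : nat) (B : 'M[R]_n).
Hypothesis hB : B \in unitmx.
Variable x0 : 'cV[R]_n.
Implicit Types (x y : 'cV[R]_n) (t : torus B).

Local Open Scope quotient_scope.

Lemma in_lattice_repr x : in_lattice B (repr (\pi_(torus B) x) - x).
Proof.
have : repr (\pi_(torus B) x) = x %[mod torus B] by rewrite reprK.
by move/eqmodP => /asboolP.
Qed.

Lemma torus_eq x y : in_lattice B (x - y) -> \pi_(torus B) x = \pi_(torus B) y.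
Proof. by move=> xy; apply/eqmodP/asboolP. Qed.

(* Coordinates in the lattice basis, shifted so that x0 is the centre of the
   fundamental cell on which all floors vanish. *)
Definition cell_coord x : 'cV[R]_n := invmx B *m (x - x0) + const_mx 2^-1.

Definition cell_index x : 'cV[int]_n := map_mx Num.floor (cell_coord x).

Definition cell_rep x : 'cV[R]_n := x - B *m map_mx intr (cell_index x).

Definition cell_interior x : Prop :=
  forall i, (cell_index x i 0)%:~R != cell_coord x i 0.

Lemma cell_coordD x (k : 'cV[int]_n) :
  cell_coord (x + B *m map_mx intr k) = cell_coord x + map_mx intr k.
Proof. by rewrite /cell_coord addrAC mulmxDr mulKmx // addrAC. Qed.

Lemma cell_indexD x (k : 'cV[int]_n) :
  cell_index (x + B *m map_mx intr k) = cell_index x + k.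
Proof.
apply/colP => i; rewrite /cell_index cell_coordD !mxE floorDrz ?intr_int //.
by rewrite intrKfloor.
Qed.

Lemma cell_rep_lattice x y : in_lattice B (x - y) -> cell_rep x = cell_rep y.
Proof.
case=> k xy; have -> : x = y + B *m map_mx intr k by rewrite -xy addrC subrK.
by rewrite /cell_rep cell_indexD map_mxD mulmxDr opprD addrACA subrr addr0.
Qed.

Lemma cell_interior_lattice x y : in_lattice B (x - y) ->
  cell_interior y -> cell_interior x.
Proof.
case=> k xy; have -> : x = y + B *m map_mx intr k by rewrite -xy addrC subrK.
move=> yi i; rewrite cell_indexD cell_coordD !mxE intrD.
by rewrite (inj_eq (addIr _)); have := yi i; rewrite !mxE.
Qed.

Lemma cell_interior_center : cell_interior x0.
Proof.
move=> i; have c0 : cell_coord x0 = const_mx 2^-1.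
  by rewrite /cell_coord subrr mulmx0 add0r.
rewrite /cell_index c0 !mxE (_ : Num.floor _ = 0).
  by rewrite eq_sym invr_eq0 pnatr_eq0.
by apply: floor_def; rewrite mulr0z add0r; lra.
Qed.

Lemma pi_cell_rep x : \pi_(torus B) (cell_rep x) = \pi_(torus B) x.
Proof.
apply: torus_eq; exists (- cell_index x).
by rewrite /cell_rep addrAC subrr add0r map_mxN mulmxN.
Qed.

Lemma cell_rep_inj t t' : cell_rep (repr t) = cell_rep (repr t') -> t = t'.
Proof. by move=> tt'; rewrite -[t]reprK -[t']reprK -pi_cell_rep tt' pi_cell_rep. Qed.

Lemma cell_rep_pi x : cell_rep (repr (\pi_(torus B) x)) = cell_rep x.
Proof. exact/cell_rep_lattice/in_lattice_repr. Qed.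

Lemma cell_interior_pi x :
  cell_interior (repr (\pi_(torus B) x)) <-> cell_interior x.
Proof.
split; apply: cell_interior_lattice; last exact: in_lattice_repr.
have [k e] := in_lattice_repr x; exists (- k).
by rewrite map_mxN mulmxN -e opprB.
Qed.

Lemma near_cell_index (p : nat) (e : 'cV[R]_(n + p)) :
  cell_interior (usubmx e) ->
  \forall z \near e, cell_interior (usubmx z) /\
    cell_index (usubmx z) = cell_index (usubmx e).
Proof.
move=> ei.
pose f (i : 'I_n) (x : 'cV[R]_(n + p)) : R := cell_coord (usubmx x) i 0.
have cf i : {for e, continuous (f i)}.
  have [D [dRe _ _]] : exists D,
      has_gradient (fun x : 'cV[R]_(n + p) => (f i x)%:C%C) e D.
    have -> : (fun x : 'cV[R]_(n + p) => (f i x)%:C%C) = (fun x : 'cV[R]_(n + p) =>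
        \sum_j (invmx B i j)%:C%C * ((x (lshift p j) 0)%:C%C + (- x0 j 0)%:C%C)
        + (2^-1)%:C%C).
      apply/funext => z; rewrite /f /cell_coord !mxE rmorphD rmorph_sum.
      congr (_ + _); apply: eq_bigr => j _.
      by rewrite !mxE -rmorphD -rmorphM.
    eexists; apply: has_gradientD; last exact: has_gradient_cst.
    apply: has_gradient_sum => j; apply: has_gradientZ; apply: has_gradientD.
      exact: has_gradient_coord.
    exact: has_gradient_cst.
  exact: differentiable_continuous dRe.
have lb i : \forall z \near e, (cell_index (usubmx e) i 0)%:~R < f i z.
  apply: (cvgr_gt _ (cf i)); rewrite lt_neqAle ei /f !mxE; exact: floor_le.
have ub i : \forall z \near e, f i z < (cell_index (usubmx e) i 0 + 1)%:~R.
  by apply: (cvgr_lt _ (cf i)); rewrite /f !mxE; exact: floorD1_gt.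
apply: filterS2 (filter_forall _ lb) (filter_forall _ ub) => z xlb xub.
have idx : cell_index (usubmx z) = cell_index (usubmx e).
  apply/colP => i; rewrite mxE; apply: floor_def.
  by rewrite (ltW (xlb i)) (xub i).
by split=> // i; rewrite idx lt_eqF // xlb.
Qed.

Lemma has_gradient_cell_rep (p : nat) (e : 'cV[R]_(n + p)) (k : 'I_n) :
  cell_interior (usubmx e) ->
  has_gradient (fun x : 'cV[R]_(n + p) => (cell_rep (usubmx x) k 0)%:C%C) e
    (row_mx (delta_mx 0 k) 0).
Proof.
move=> ei.
pose c := (B *m map_mx intr (cell_index (usubmx e))) k 0.
have H := has_gradientD (has_gradient_coord (lshift p k) e)
  (has_gradient_cst (- c)%:C%C e).
have nH : {near e, (fun x : 'cV[R]_(n + p) => (x (lshift p k) 0)%:C%C + (- c)%:C%C)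
    =1 (fun x : 'cV[R]_(n + p) => (cell_rep (usubmx x) k 0)%:C%C)}.
  apply: filterS (near_cell_index ei) => z [_ idx].
  rewrite -rmorphD; congr (_%:C%C).
  by rewrite /cell_rep idx /c; move: (B *m _) => X; rewrite !mxE.
move: (has_gradient_near nH H); congr has_gradient.
by rewrite addr0 -delta_mx_lshift.
Qed.

End TorusSection.

(** * Holomorphic functions on the twistor space *)

Section TwistorCalculus.
Variables (R : realType) (n : nat) (B I J K : 'M[R]_n).
Implicit Types (f : twistor B -> R[i]) (z : twistor B) (U : set (twistor B)).

Lemma twistor_liftK z : twistor_proj B (twistor_lift z) = z.
Proof.
rewrite /twistor_proj /twistor_lift col_mxKu col_mxKd reprK radial_val.
by case: z.
Qed.

Definition twistor_gradient f z (D : 'rV[R[i]]_(n + 3)) : Prop :=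
  has_gradient (fun e => f (twistor_proj B e)) (twistor_lift z) D.

Lemma twistor_gradient_diff f z D : twistor_gradient f z D ->
  twistor_differentiable f z /\ twistor_diff f z = D.
Proof. by case=> dRe dIm ->. Qed.

Lemma twistor_diff_gradient f z :
  twistor_differentiable f z -> twistor_gradient f z (twistor_diff f z).
Proof. by case=> dRe dIm; split. Qed.

Definition type10 z (D : 'rV[R[i]]_(n + 3)) : Prop := forall w, tangent z w ->
  D *m (complexify (twistor_cs I J K z) *m w) = 'i%C *: (D *m w).

Lemma holomorphic_onP U f :
  (forall z, U z -> exists D, twistor_gradient f z D /\ type10 z D) <->
  holomorphic_on I J K U f.
Proof.
split=> [H z /H[D [/twistor_gradient_diff[df <-] tD]]|H z /H[df tD]]; first by split.
by exists (twistor_diff f z); split=> //; exact: twistor_diff_gradient.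
Qed.

Lemma type10D z D D' : type10 z D -> type10 z D' -> type10 z (D + D').
Proof. by move=> tD tD' w zw; rewrite !mulmxDl tD // tD' // scalerDr. Qed.

Lemma type10Z z c D : type10 z D -> type10 z (c *: D).
Proof.
by move=> tD w zw; rewrite -!scalemxAl tD // !scalerA mulrC.
Qed.

Lemma holomorphic_on_cst U c : holomorphic_on I J K U (fun=> c).
Proof.
apply/holomorphic_onP => z _; exists 0; split; first exact: has_gradient_cst.
by move=> w _; rewrite !mul0mx scaler0.
Qed.

Lemma holomorphic_onM U f h : holomorphic_on I J K U f ->
  holomorphic_on I J K U h -> holomorphic_on I J K U (fun z => f z * h z).
Proof.
move=> /holomorphic_onP Hf /holomorphic_onP Hh; apply/holomorphic_onP => z Uz.
have [D [gD tD]] := Hf z Uz; have [D' [gD' tD']] := Hh z Uz.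
eexists; split; first exact: has_gradientM gD gD'.
by apply: type10D; apply: type10Z.
Qed.

Lemma holomorphic_on_eq U f h : twistor_open U -> (forall z, U z -> f z = h z) ->
  holomorphic_on I J K U f -> holomorphic_on I J K U h.
Proof.
move=> oU fh /holomorphic_onP Hf; apply/holomorphic_onP => z Uz.
have [D [gD tD]] := Hf z Uz; exists D; split=> //.
apply: has_gradient_near gD.
have : nbhs (twistor_lift z) [set e | dsubmx e != 0 /\ U (twistor_proj B e)]%classic.
  apply: open_nbhs_nbhs; split=> //=; rewrite twistor_liftK; split=> //.
  by rewrite /twistor_lift col_mxKd sphere_neq0.
by apply: filterS => e [_ Ue]; exact: fh.
Qed.

Lemma type10_split z (X : 'rV[R[i]]_n) (Y : 'rV[R[i]]_3) :
  X *m complexify (I_at I J K (val z.2)) = 'i%C *: X ->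
  (forall w : 'cV[R[i]]_3, (complexify (val z.2))^T *m w = 0 ->
    Y *m (complexify (cross_mx (val z.2)) *m w) = 'i%C *: (Y *m w)) ->
  type10 z (row_mx X Y).
Proof.
move=> hX hY w; rewrite /tangent => zw.
rewrite -[w]vsubmxK /twistor_cs /complexify map_block_mx !map_mx0.
rewrite mul_block_col !mul0mx add0r addr0 !mul_row_col.
rewrite mulmxA [X *m _]hX scalerDr -scalemxAl; congr (_ + _).
exact: hY.
Qed.

Lemma T10_split z (w : 'cV[R[i]]_(n + 3)) : T10 I J K z w ->
  [/\ complexify (I_at I J K (val z.2)) *m usubmx w = 'i%C *: usubmx w,
      (complexify (val z.2))^T *m dsubmx w = 0 &
      complexify (cross_mx (val z.2)) *m dsubmx w = 'i%C *: dsubmx w].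
Proof.
case=> zw; rewrite -{1 2}[w]vsubmxK /twistor_cs /complexify map_block_mx !map_mx0.
rewrite mul_block_col !mul0mx add0r addr0 scale_col_mx => /eq_col_mx[h1 h2].
by split.
Qed.

Definition torus_bivector (q : sphere R -> 'M[R[i]]_n) : bivector_field B :=
  fun z => block_mx (q z.2) 0 0 0.

Lemma torus_bivector_section q :
  (forall a, (q a)^T = - q a) ->
  (forall a, complexify (I_at I J K (val a)) *m q a = 'i%C *: q a) ->
  section_Lambda2_T10 I J K (torus_bivector q).
Proof.
move=> qT qI z; split.
  by rewrite /torus_bivector tr_block_mx !trmx0 qT opp_block_mx !oppr0.
move=> j; split.
  rewrite /tangent; suff -> : dsubmx (col j (torus_bivector q z)) = 0.
    by rewrite mulmx0.
  apply/colP => i; rewrite mxE [LHS]mxE [RHS]mxE /torus_bivector.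
  by case: (split_ordP j) => l ->; rewrite ?block_mxEdl ?block_mxEdr mxE.
rewrite colE mulmxA; have -> : complexify (twistor_cs I J K z) *m torus_bivector q z =
    'i%C *: torus_bivector q z.
  rewrite /twistor_cs /complexify map_block_mx !map_mx0 /torus_bivector.
  rewrite mulmx_block !mul0mx !mulmx0 !addr0 scale_block_mx !scaler0.
  by rewrite [map_mx _ _ *m _]qI.
by rewrite -scalemxAl.
Qed.

Lemma derive_invariant (p : nat) (F : 'cV[R]_p -> R) (e v : 'cV[R]_p) :
  (forall h, F (h *: v + e) = F e) -> 'D_v F e = 0.
Proof.
move=> Fv; rewrite /derive.
have -> : (fun h => h^-1 *: ((F \o shift e) (h *: v) - F e)) = cst 0.
  by apply/funext => h /=; rewrite Fv subrr scaler0.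
exact: lim_cst.
Qed.

Lemma torus_bivector_schouten q z (i j k : 'I_(n + 3)) :
  schouten (torus_bivector q) (torus_bivector q) z i j k = 0.
Proof.
have term a b c : schouten_term (torus_bivector q) (torus_bivector q) z a b c = 0.
  apply: big1 => l _; case: (split_ordP l) => r ->; last first.
    suff -> : torus_bivector q z a (rshift n r) = 0 by rewrite !mul0r addr0.
    by rewrite /torus_bivector; case: (split_ordP a) => d ->;
      rewrite ?block_mxEur ?block_mxEdr mxE.
  have d0 : twistor_diff (fun z' : twistor B => torus_bivector q z' b c) z 0
      (lshift 3 r) = 0.
    have inv (F : sphere R -> R) :
        'D_(delta_mx (lshift 3 r) 0) (fun e => F (twistor_proj B e).2)
          (twistor_lift z) = 0.
      apply: derive_invariant => h; rewrite /twistor_proj /=; congr (F (radial _)).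
      by apply/colP => d; rewrite !mxE eq_rlshift /= mulr0 add0r.
    rewrite mxE.
    pose Q a : 'M[R[i]]_(n + 3) := block_mx (q a) 0 0 0.
    rewrite (inv (fun a => complex.Re (Q a b c))).
    by rewrite (inv (fun a => complex.Im (Q a b c))).
  by rewrite d0 !mulr0 addr0.
by rewrite /schouten !term !addr0.
Qed.

End TwistorCalculus.

Section SphereCharts.
Variables (R : realType) (n : nat) (B : 'M[R]_n).
Implicit Types (z : twistor B) (b : bool).

Definition sphere_type10 (a : 'cV[R]_3) (D : 'rV[R[i]]_3) : Prop :=
  forall w : 'cV[R[i]]_3, (complexify a)^T *m w = 0 ->
    D *m (complexify (cross_mx a) *m w) = 'i%C *: (D *m w).

Lemma sphere_type10_0 a : sphere_type10 a 0.
Proof. by move=> w _; rewrite !mul0mx scaler0. Qed.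

Lemma sphere_tangentE (a : 'cV[R]_3) (w : 'cV[R[i]]_3) :
  ((complexify a)^T *m w) 0 0 = (a 0 0)%:C%C * w 0 0 + (a 1 0)%:C%C * w 1 0
    + (a 2%:R 0)%:C%C * w 2%:R 0.
Proof. by rewrite mxE sum_ord3 !mxE. Qed.

Lemma cross_mx_entries (a : 'cV[R]_3) (w : 'cV[R[i]]_3) :
  let x := complexify (cross_mx a) *m w in
  [/\ x 0 0 = (a 1 0)%:C%C * w 2%:R 0 - (a 2%:R 0)%:C%C * w 1 0,
      x 1 0 = (a 2%:R 0)%:C%C * w 0 0 - (a 0 0)%:C%C * w 2%:R 0 &
      x 2%:R 0 = (a 0 0)%:C%C * w 1 0 - (a 1 0)%:C%C * w 0 0].
Proof.
have h11 : 1 + 1 = 2%:R :> 'I_3 by exact: val_inj.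
have h12 : 1 + 2%:R = 0 :> 'I_3 by exact: val_inj.
have h21 : 2%:R + 1 = 0 :> 'I_3 by exact: val_inj.
have h22 : 2%:R + 2%:R = 1 :> 'I_3 by exact: val_inj.
by split; rewrite cross_mxE; rewrite ?h11 ?h12 ?h21 ?h22 ?add0r.
Qed.

Lemma cross_mx_tangent (a : 'cV[R]_3) (w : 'cV[R[i]]_3) :
  (complexify a)^T *m (complexify (cross_mx a) *m w) = 0.
Proof.
have [x0 x1 x2] := cross_mx_entries a w.
apply/matrixP => i j; rewrite !ord1 sphere_tangentE x0 x1 x2 [RHS]mxE.
ring.
Qed.

Lemma chart_t_gradient b z : chart_dom b (val z.2) ->
  exists D : 'rV[R[i]]_3,
    [/\ twistor_gradient (fun z' => chart_t b (val z'.2)) z (row_mx 0 D),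
        sphere_type10 (val z.2) D &
        forall w : 'cV[R[i]]_3, (complexify (val z.2))^T *m w = 0 ->
          complexify (cross_mx (val z.2)) *m w = 'i%C *: w ->
          D *m w = 0 -> w = 0].
Proof.
move=> zb; pose e := twistor_lift z.
have ez : dsubmx e = val z.2 by rewrite /e /twistor_lift col_mxKd.
have e1 : sqnorm (dsubmx e) = 1 by rewrite ez sqnorm_sphere.
have eb : chart_sign R b * dsubmx e 0 0 != 1 by rewrite ez.
have [D [gD]] := has_gradient_sphere_chart e1 eb.
have E := sqnorm_eq1 e1.
have s2 := chart_sign_sqr R b.
have sa : 1 - chart_sign R b * dsubmx e 0 0 != 0 by rewrite subr_eq0 eq_sym.
rewrite -ez => DE; exists D; split; first exact: gD.
all: move: (dsubmx e) => a in E sa DE *; move: (chart_sign R b) => s in s2 sa DE *.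
all: set A := sphere_chart s a in DE.
all: pose g : R[i] := ((1 - s * a 0 0)^-1)%:C%C.
all: have hi : 'i%C * 'i%C = -1 :> R[i] by rewrite -expr2 sqr_i.
all: have hs : s%:C%C * s%:C%C = 1 :> R[i] by rewrite -rmorphM s2.
all: have ha : (a 0 0)%:C%C * (a 0 0)%:C%C + (a 1 0)%:C%C * (a 1 0)%:C%C
    + (a 2%:R 0)%:C%C * (a 2%:R 0)%:C%C = 1 :> R[i] by rewrite -!rmorphM -!rmorphD E.
all: have hg : g * (1 - s%:C%C * (a 0 0)%:C%C) = 1
  by rewrite -rmorphM -(rmorph1 (real_complex R)) -rmorphB -rmorphM mulVf.
all: have AE : A = ((a 2%:R 0)%:C%C + 'i%C * s%:C%C * (a 1 0)%:C%C) * g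
  by rewrite /A /sphere_chart; congr (_ * _); apply/eqP; rewrite eq_complex /=;
     apply/andP; split; apply/eqP; ring.
all: have sgE : (s / (1 - s * a 0 0))%:C%C = s%:C%C * g by rewrite -rmorphM.
all: rewrite -/g AE sgE in DE.
- move=> w aw; have := aw; move/matrixP/(_ 0 0); rewrite sphere_tangentE mxE => hw.
  have [x0 x1 x2] := cross_mx_entries a w.
  apply/matrixP => i j; rewrite !ord1 [RHS]mxE !DE ?cross_mx_tangent //.
  by rewrite x0 x1 x2; apply: chart_derivative_holomorphic.
- move=> w aw cw Dw; have := aw.
  move/matrixP/(_ 0 0); rewrite sphere_tangentE mxE => hw.
  have [x0 x1 x2] := cross_mx_entries a w.
  rewrite cw !mxE in x0 x1 x2.
  have := Dw; move/matrixP/(_ 0 0); rewrite DE // [RHS]mxE => D0.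
  have [w0 w1 w2] := chart_derivative_inj hi hs ha hw hg
    (esym x0) (esym x1) (esym x2) D0.
  apply/colP => k; rewrite mxE; case: k => [[|[|[|//]]] kP].
  + by rewrite (_ : Ordinal _ = 0) //; exact: val_inj.
  + by rewrite (_ : Ordinal _ = 1) //; exact: val_inj.
  + by rewrite (_ : Ordinal _ = 2%:R) //; exact: val_inj.
Qed.

Lemma chart_gradients b z : chart_dom b (val z.2) ->
  exists Dt Du Dv : 'rV[R[i]]_3,
    [/\ twistor_gradient (fun z' => chart_t b (val z'.2)) z (row_mx 0 Dt) /\
         sphere_type10 (val z.2) Dt,
        twistor_gradient (fun z' => chart_u b (val z'.2)) z (row_mx 0 Du) /\
        sphere_type10 (val z.2) Du,
        twistor_gradient (fun z' => chart_v b (val z'.2)) z (row_mx 0 Dv) /\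
        sphere_type10 (val z.2) Dv &
        forall w : 'cV[R[i]]_3, (complexify (val z.2))^T *m w = 0 ->
          complexify (cross_mx (val z.2)) *m w = 'i%C *: w ->
          Dt *m w = 0 -> w = 0].
Proof.
move=> /chart_t_gradient[D [gD tD injD]].
have g1 : twistor_gradient (fun=> 1) z (row_mx 0 0).
  by rewrite row_mx0; exact: has_gradient_cst.
have t0 : sphere_type10 (val z.2) 0 by exact: sphere_type10_0.
by case: b gD => gD; [exists D, 0, D|exists D, D, 0]; split.
Qed.

End SphereCharts.

Lemma complexify_eq_i (R : realType) n (x y : 'cV[R]_n) :
  complexify x = 'i%C *: complexify y -> x = 0.
Proof.
move/colP => E; apply/colP => l; have := E l; rewrite !mxE.
by move/(congr1 (@complex.Re R)); rewrite mulrC ReiNIm /= oppr0.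
Qed.

(** * The bivectors in holomorphic charts *)

Section HyperkahlerTorus.
Variables (R : realType) (n m : nat) (B G I J K : 'M[R]_n).
Hypotheses (hn : n = (4 * m)%N) (hB : B \in unitmx) (hK : hyperkahler G I J K).
Implicit Types (z : twistor B) (a : sphere R) (b g h : bool).

Let Ic := complexify I.
Let Jc := complexify J.
Let Kc := complexify K.
Let Gc := complexify (invmx G).

Lemma metric_unit : G \in unitmx.
Proof.
case: hK => -[_ Gpos] _ _ _; rewrite -row_free_unit; apply: inj_row_free => v vG.
apply/eqP/negP => /negP v0.
have : 0 < ((v^T)^T *m G *m v^T) 0 0 by apply: Gpos; rewrite trmx_eq0.
by rewrite trmxK vG mul0mx mxE ltxx.
Qed.

Lemma metric_inv_skew (A : 'M[R]_n) : orthogonal_complex_structure G A ->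
  invmx G *m A^T = - (A *m invmx G).
Proof.
case=> AA AGA; have Gu := metric_unit.
have AG : A^T *m G = - (G *m A).
  by rewrite -{2}AGA -!mulmxA AA !mulmxN mulmx1 opprK.
rewrite -[A^T](mulmxK Gu) AG mulNmx mulmxN.
by rewrite -!mulmxA mulKmx.
Qed.

Lemma dual_bivectorE : dual_bivector (fundamental_form G I) = I *m invmx G.
Proof.
case: (hK) => -[GT _] [hI _ _] _ _; have Gu := metric_unit.
rewrite /dual_bivector /fundamental_form trmx_mul GT trmxK.
have inv : G *m I *m (- (I *m invmx G)) = 1%:M.
  rewrite mulmxN mulmxA -[G *m I *m I]mulmxA; case: hI => -> _.
  by rewrite mulmxN mulmx1 mulNmx opprK mulmxV.
have [GIu _] := mulmx1_unit inv.
have -> : invmx (G *m I) = - (I *m invmx G).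
  by rewrite -[invmx _]mulmx1 -inv mulmxA mulVmx // mul1mx.
rewrite -metric_inv_skew // trmx_mul trmxK trmx_inv GT.
by [].
Qed.

Let hII : Ic *m Ic = - 1%:M.
Proof.
case: (hK) => _ [[II _] _ _] _ _.
by rewrite /Ic /complexify -map_mxM II map_mxN map_mx1.
Qed.

Let hJJ : Jc *m Jc = - 1%:M.
Proof.
case: (hK) => _ [_ [JJ _] _] _ _.
by rewrite /Jc /complexify -map_mxM JJ map_mxN map_mx1.
Qed.

Let hIJ : Ic *m Jc = Kc.
Proof. by case: (hK) => _ _ IJ _; rewrite /Ic /Jc /complexify -map_mxM IJ. Qed.

Let hJI : Jc *m Ic = - Kc.
Proof.
by case: (hK) => _ _ _ JI; rewrite /Ic /Jc /complexify -map_mxM JI map_mxN.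
Qed.

Let hGI : Gc *m Ic^T = - (Ic *m Gc).
Proof.
case: (hK) => _ [hI _ _] _ _.
by rewrite /Ic /Gc /complexify matrix.map_trmx -!map_mxM metric_inv_skew // map_mxN.
Qed.

Let hGJ : Gc *m Jc^T = - (Jc *m Gc).
Proof.
case: (hK) => _ [_ hJ _] _ _.
by rewrite /Jc /Gc /complexify matrix.map_trmx -!map_mxM metric_inv_skew // map_mxN.
Qed.

Let hGT : Gc^T = Gc.
Proof.
by case: (hK) => -[GT _] _ _ _; rewrite /Gc /complexify matrix.map_trmx trmx_inv GT.
Qed.

Let hi : 'i%C * 'i%C = -1 :> R[i].
Proof. by rewrite -expr2 sqr_i. Qed.

Let sphereE a : (val a 0 0)%:C%C * (val a 0 0)%:C%C
  + (val a 1 0)%:C%C * (val a 1 0)%:C%C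
  + (val a 2%:R 0)%:C%C * (val a 2%:R 0)%:C%C = 1 :> R[i].
Proof. by rewrite -!rmorphM -!rmorphD (sqnorm_eq1 (sqnorm_sphere a)). Qed.

Lemma I_atE a : complexify (I_at I J K (val a)) =
  quat Ic Jc Kc 0 (val a 0 0)%:C%C (val a 1 0)%:C%C (val a 2%:R 0)%:C%C.
Proof. by rewrite /quat /I_at /complexify !map_mxD !map_mxZ raddf0 add0r. Qed.

(* The coefficients of L1 (g = false) and L2 (g = true): both are multiples of
   (1, conj lambda), and the second is lambda times the first. *)
Definition fibre_p g a : R[i] :=
  if g then (val a 2%:R 0)%:C%C + 'i%C * (val a 1 0)%:C%C else 1 - (val a 0 0)%:C%C.
Definition fibre_q g a : R[i] :=
  if g then 1 + (val a 0 0)%:C%C else (val a 2%:R 0)%:C%C - 'i%C * (val a 1 0)%:C%C.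

Definition twistor_poisson g h a : 'M[R[i]]_n :=
  plane_bivector Ic Jc Kc Gc 'i%C (fibre_p g a) (fibre_q g a)
    (fibre_p h a) (fibre_q h a).

Lemma twistor_poisson_skew g h a :
  (twistor_poisson g h a)^T = - twistor_poisson g h a.
Proof.
apply: (plane_bivector_skew hII hJJ hIJ hJI hGI hGJ hGT hi); have ha := sphereE a.
have E : (1 - (val a 0 0)%:C%C) * (1 + (val a 0 0)%:C%C) =
    ((val a 2%:R 0)%:C%C - 'i%C * (val a 1 0)%:C%C) *
    ((val a 2%:R 0)%:C%C + 'i%C * (val a 1 0)%:C%C) :> R[i].
  transitivity (1 - (val a 0 0)%:C%C * (val a 0 0)%:C%C : R[i]); first by ring.
  by rewrite -ha; ring: hi.
by case: g; case: h; rewrite /fibre_p /fibre_q;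
  [exact: mulrC|rewrite mulrC -E mulrC|exact: E|exact: mulrC].
Qed.

Lemma twistor_poisson_type g h a :
  complexify (I_at I J K (val a)) *m twistor_poisson g h a =
  'i%C *: twistor_poisson g h a.
Proof.
rewrite I_atE; apply: plane_bivector_type; have ha := sphereE a.
case: g; first exact: (plane_type_N hII hJJ hIJ hJI hi).
exact: (plane_type_S hII hJJ hIJ hJI hi).
Qed.

Lemma twistor_bivectorE z :
  twistor_bivector I J K G z = torus_bivector (twistor_poisson false true) z.
Proof.
rewrite /twistor_bivector /part20 dual_bivectorE /section_diff /torus_bivector.
rewrite tr_col_mx trmx1 trmx0 mul_col_mx mul1mx mul0mx.
rewrite mul_col_row mulmx1 mulmx0 mul0mx mulmx0.
have -> : proj10 I J K z = block_mx
    (2^-1 *: (1%:M - 'i%C *: complexify (I_at I J K (val z.2)))) 0 0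
    (2^-1 *: (1%:M - 'i%C *: complexify (cross_mx (val z.2)))).
  rewrite /proj10 /twistor_cs /complexify map_block_mx !map_mx0.
  rewrite -[1%:M in LHS]/(1%:M : 'M[R[i]]_(n + 3)) scalar_mx_block scale_block_mx.
  rewrite opp_block_mx add_block_mx scale_block_mx.
  by rewrite !scaler0 !oppr0 !addr0 !scaler0.
have -> (X : 'M[R]_n) : complexify (block_mx X 0 0 0 : 'M[R]_(n + 3)) =
    block_mx (complexify X) 0 0 0.
  by rewrite /complexify map_block_mx !map_mx0.
rewrite tr_block_mx !trmx0 !mulmx_block.
rewrite !(mulmx0, mul0mx, addr0); congr (block_mx _ _ _ _).
rewrite {2}/complexify map_mxM I_atE.
exact: (part20_plane_bivector hII hJJ hIJ hJI hGI hGJ hi (sphereE _)).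
Qed.

Lemma hopf_relations b a : chart_dom b (val a) ->
  [/\ hopf_p b (val a) * chart_u b (val a) = 1 - (val a 0 0)%:C%C,
      hopf_p b (val a) * chart_v b (val a) =
        (val a 2%:R 0)%:C%C + 'i%C * (val a 1 0)%:C%C,
      hopf_q b (val a) * chart_u b (val a) =
        (val a 2%:R 0)%:C%C - 'i%C * (val a 1 0)%:C%C &
      hopf_q b (val a) * chart_v b (val a) = 1 + (val a 0 0)%:C%C].
Proof.
case/(hopf_chart (sqnorm_sphere a)) => -> -> -> ->.
rewrite rmorphB rmorphD rmorph1 [Complex _ (val a 1 0)]complexE.
by rewrite [Complex _ (- _)]complexE /= rmorphN mulrN.
Qed.

Definition chart_uv g b a : R[i] :=
  if g then chart_v b (val a) else chart_u b (val a).

Lemma twistor_poisson_chart g h b a : chart_dom b (val a) ->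
  let p := hopf_p b (val a) in let q := hopf_q b (val a) in
  twistor_poisson g h a = (chart_uv g b a * chart_uv h b a) *:
    plane_bivector Ic Jc Kc Gc 'i%C p q p q.
Proof.
move=> /hopf_relations[h1 h2 h3 h4] p q.
rewrite -plane_bivectorZ /twistor_poisson.
have pE k : fibre_p k a = chart_uv k b a * p.
  by case: k; rewrite /chart_uv /fibre_p /p [RHS]mulrC ?h1 ?h2.
have qE k : fibre_q k a = chart_uv k b a * q.
  by case: k; rewrite /chart_uv /fibre_q /q [RHS]mulrC ?h3 ?h4.
by rewrite !pE !qE.
Qed.

Section Coframe.
Variables (k : nat) (Phi : 'M[R[i]]_(k, n)) (C : 'M[R[i]]_(n, k)).
Hypotheses (PhiI : Phi *m Ic = - 'i%C *: Phi).
Hypothesis (PhiC : quat Ic Jc Kc 1 'i%C 0 0 = C *m Phi).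
Variables (x0 : 'cV[R]_n) (b : bool).

Definition chart_nbhd : set (twistor B) :=
  [set z | cell_interior B x0 (repr z.1) /\ chart_dom b (val z.2)]%classic.

Definition coframe_at a : 'M[R[i]]_(k, n) :=
  Phi *m plane Ic Jc Kc (chart_u b (val a)) (- chart_v b (val a)).

Definition chart_coord (j : 'I_(k + 1)) z : R[i] :=
  match fintype.split j with
  | inl l => (coframe_at z.2 *m complexify (cell_rep B x0 (repr z.1))) l 0
  | inr _ => chart_t b (val z.2)
  end.

Lemma chart_nbhd_open : twistor_open chart_nbhd.
Proof.
rewrite /twistor_open openE => e [e0 [/= ce de]].
have [D [dRe _ _]] : exists D,
    has_gradient (fun x => (val (radial (dsubmx x)) 0 0)%:C%C) e D.
  by eexists; exact: has_gradient_radial_neq0.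
have cRe := differentiable_continuous dRe.
have near_dom : \forall x \near e, chart_dom b (val (radial (dsubmx x))).
  have s0 : chart_sign R b != 0.
    apply: contra_eq_neq (chart_sign_sqr R b) => ->.
    by rewrite mulr0 eq_sym oner_eq0.
  have domE y : chart_dom b y <-> y 0 0 - (chart_sign R b)^-1 != 0.
    rewrite /chart_dom subr_eq0 -(inj_eq (mulfI s0) (y 0 0)) divff //.
  have ne : val (radial (dsubmx e)) 0 0 - (chart_sign R b)^-1 != 0 by apply/domE.
  have cB := cvgB cRe (cvg_cst (chart_sign R b)^-1).
  have FF : Filter (nbhs e) by exact: nbhs_filter.
  have nz : \forall x \near e,
      val (radial (dsubmx x)) 0 0 - (chart_sign R b)^-1 != 0.
    exact: cvgr_neq0 (cB FF FF) ne.
  by apply: filterS nz => x; move/domE.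
have near_cell : \forall x \near e,
    cell_interior B x0 (repr (\pi_(torus B)%qT (usubmx x))).
  have ci := (cell_interior_pi hB x0 (usubmx e)).1 ce.
  have nc := near_cell_index ci.
  by apply: filterS nc => x [xi _]; exact: (cell_interior_pi hB x0 (usubmx x)).2 xi.
apply: filterS3 (near_dsubmx_neq0 e0) near_cell near_dom => x ? ? ?.
by split=> //; split.
Qed.

Lemma linear_cell_gradient (M : 'M[R[i]]_(k, n)) z (j : 'I_k) :
  cell_interior B x0 (repr z.1) ->
  twistor_gradient
    (fun z' => (M *m complexify (cell_rep B x0 (repr z'.1))) j 0) z
    (row_mx (row j M) 0).
Proof.
move=> zi.
have zE : usubmx (twistor_lift z) = repr z.1 by rewrite /twistor_lift col_mxKu.
have ei : cell_interior B x0 (usubmx (twistor_lift z)) by rewrite zE.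
have H := has_gradient_sum (fun l => has_gradientZ (M j l)
  (has_gradient_cell_rep l ei)).
have Mrow : \sum_l M j l *: row_mx (delta_mx 0 l) (0 : 'M[R[i]]_(1, 3)) =
    row_mx (row j M) 0.
  apply/rowP => d; rewrite summxE.
  case: (split_ordP d) => r ->; rewrite ?row_mxEl ?row_mxEr ?mxE.
    rewrite (bigD1 r) //= big1 => [|l lr]; rewrite mxE row_mxEl mxE.
      by rewrite !eqxx mulr1 addr0.
    by rewrite [r == l]eq_sym (negbTE lr) mulr0.
  by apply: big1 => l _; rewrite mxE row_mxEr mxE mulr0.
rewrite -Mrow; move: H; congr has_gradient.
apply/funext => e; rewrite [RHS]mxE; apply: eq_bigr => l _.
by rewrite [complexify _ _ _]mxE /= cell_rep_pi.
Qed.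

Lemma plane_linear (p q : R[i]) : plane Ic Jc Kc p q = p%:M + q *: Jc.
Proof. by rewrite /plane /quat !scale0r !addr0. Qed.

Lemma coframe_gradient z (Du Dv : 'rV[R[i]]_3) (j : 'I_k) :
  cell_interior B x0 (repr z.1) ->
  twistor_gradient (fun z' => chart_u b (val z'.2)) z (row_mx 0 Du) ->
  twistor_gradient (fun z' => chart_v b (val z'.2)) z (row_mx 0 Dv) ->
  exists c d, twistor_gradient
    (fun z' => (coframe_at z'.2 *m complexify (cell_rep B x0 (repr z'.1))) j 0) z
    (row_mx (row j (coframe_at z.2)) (c *: Du + d *: Dv)).
Proof.
move=> zi gu gv.
have g1 := has_gradientM gu (linear_cell_gradient Phi j zi).
have g2 := has_gradientM gv (linear_cell_gradient (- (Phi *m Jc)) j zi).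
cbv beta in g1, g2; rewrite !twistor_liftK in g1 g2.
exists ((Phi *m complexify (cell_rep B x0 (repr z.1))) j 0).
exists ((- (Phi *m Jc) *m complexify (cell_rep B x0 (repr z.1))) j 0).
move: (has_gradientD g1 g2); congr has_gradient.
  apply/funext => e; rewrite /coframe_at plane_linear mulmxDr mul_mx_scalar.
  rewrite -scalemxAr mulmxDl -!scalemxAl scaleNr mulNmx.
  by rewrite [RHS]mxE [X in _ = X + _]mxE [in RHS]mxE [in RHS]mxE !mxE mulrN.
rewrite !scale_row_mx !scaler0 !add_row_mx !addr0 !add0r; congr row_mx.
apply/rowP => l; rewrite /coframe_at plane_linear mulmxDr mul_mx_scalar.
by rewrite -scalemxAr scaleNr !mxE mulrN.
Qed.

Lemma chart_coord_gradients z : chart_nbhd z ->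
  exists Dt : 'rV[R[i]]_3,
  [/\ sphere_type10 (val z.2) Dt,
      twistor_gradient (chart_coord (rshift k 0)) z (row_mx 0 Dt),
      forall j, exists2 D, sphere_type10 (val z.2) D &
        twistor_gradient (chart_coord (lshift 1 j)) z
          (row_mx (row j (coframe_at z.2)) D) &
      forall w : 'cV[R[i]]_3, (complexify (val z.2))^T *m w = 0 ->
        complexify (cross_mx (val z.2)) *m w = 'i%C *: w ->
        Dt *m w = 0 -> w = 0].
Proof.
case=> zi /chart_gradients[Dt [Du [Dv [[gt tt] [gu tu] [gv tv] inj]]]].
exists Dt; split=> //.
  move: gt; congr has_gradient; apply/funext => e.
  by rewrite /chart_coord (unsplitK (inr _)).
move=> j; have [c [d gz]] := coframe_gradient j zi gu gv.
exists (c *: Du + d *: Dv).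
  move=> w aw; rewrite !mulmxDl -!scalemxAl tu // tv //.
  by rewrite scalerDr !scalerA ![_ * 'i%C]mulrC.
move: gz; congr has_gradient; apply/funext => e.
by rewrite /chart_coord (unsplitK (inl _)).
Qed.

Lemma coframe_at_type z : chart_nbhd z ->
  coframe_at z.2 *m complexify (I_at I J K (val z.2)) = 'i%C *: coframe_at z.2.
Proof.
case=> _ /hopf_relations[h1 h2 h3 h4].
by rewrite I_atE; apply: (coframe_type hII hJJ hIJ hJI hi h1 h2 h3 h4 PhiI).
Qed.

Lemma coframe_at_inj z (l : nat) (w : 'M[R[i]]_(n, l)) : chart_nbhd z ->
  coframe_at z.2 *m w = 0 ->
  w = 'i%C *: (complexify (I_at I J K (val z.2)) *m w).
Proof.
case=> _ /hopf_relations[h1 h2 h3 h4].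
by rewrite I_atE; apply: (coframe_inj hII hJJ hIJ hJI hi h1 h2 h3 h4 PhiC).
Qed.

Lemma chart_coord_holomorphic j : holomorphic_on I J K chart_nbhd (chart_coord j).
Proof.
apply/holomorphic_onP => z Uz.
have [Dt [tt gt gz _]] := chart_coord_gradients Uz.
case: (split_ordP j) => l ->.
  have [D tD gD] := gz l; exists (row_mx (row l (coframe_at z.2)) D); split=> //.
  apply: type10_split => //.
  by rewrite -row_mul coframe_at_type // linearZ.
rewrite (ord1 l); exists (row_mx 0 Dt); split=> //.
by apply: type10_split => //; rewrite mul0mx scaler0.
Qed.

Lemma chart_coord_coordinates : holomorphic_coordinates I J K chart_nbhd chart_coord.
Proof.
split; [exact: chart_nbhd_open|exact: chart_coord_holomorphic| |].
- move=> z z' Uz Uz' E.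
  have zz2 : z.2 = z'.2.
    apply: val_inj; have := E (rshift k 0).
    rewrite /chart_coord (unsplitK (inr _)); apply: chart_t_inj.
    + exact: sqnorm_sphere.
    + exact: sqnorm_sphere.
    + by case: Uz.
    + by case: Uz'.
  set y := cell_rep B x0 (repr z.1); set y' := cell_rep B x0 (repr z'.1).
  have : coframe_at z.2 *m complexify (y - y') = 0.
    have E1 : coframe_at z.2 *m complexify y = coframe_at z.2 *m complexify y'.
      apply/colP => l; have := E (lshift 1 l).
      by rewrite /chart_coord (unsplitK (inl _)) -zz2.
    rewrite (_ : complexify (y - y') = complexify y - complexify y').
      by rewrite mulmxBr E1 subrr.
    exact: map_mxB.
  move=> /(coframe_at_inj Uz); rewrite /complexify -map_mxM => E2.
  have yy : y - y' = 0 := complexify_eq_i E2.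
  have zz1 : z.1 = z'.1.
    by apply: (@cell_rep_inj _ _ _ x0 z.1 z'.1); apply/eqP; rewrite -subr_eq0 -/y yy.
  by case: z z' zz1 zz2 {Uz Uz' E y y' E2 yy} => [z1 z2] [z1' z2'] /= -> ->.
- move=> z w Uz /T10_split[w1 w2 w3] E.
  have [Dt [_ gt gz inj]] := chart_coord_gradients Uz.
  have wd : dsubmx w = 0.
    apply: inj => //; have := E (rshift k 0).
    have [_ ->] := twistor_gradient_diff gt.
    by rewrite -[w in LHS]vsubmxK mul_row_col mul0mx add0r.
  have wu : coframe_at z.2 *m usubmx w = 0.
    apply/row_matrixP => l; have := E (lshift 1 l); have [D _ gD] := gz l.
    have [_ ->] := twistor_gradient_diff gD.
    by rewrite -[w in LHS]vsubmxK mul_row_col wd mulmx0 addr0 row_mul row0.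
  have wu0 : usubmx w = 0.
    have := coframe_at_inj Uz wu; rewrite w1 scalerA hi scaleN1r => /eqP.
    rewrite -addr_eq0 -mulr2n -scaler_nat scaler_eq0 pnatr_eq0 /=.
    by move/eqP.
  by rewrite -[w]vsubmxK wu0 wd col_mx0.
Qed.

Lemma chart_coord_pairing g h z (i j : 'I_(k + 1)) : chart_nbhd z ->
  (twistor_diff (chart_coord i) z *m torus_bivector (twistor_poisson g h) z
    *m (twistor_diff (chart_coord j) z)^T) 0 0 =
  chart_uv g b z.2 * chart_uv h b z.2 *
    (match fintype.split i, fintype.split j with
     | inl i', inl j' => ((-2 * 'i%C) *: (Phi *m Jc *m Gc *m Phi^T)) i' j'
     | _, _ => 0
     end).
Proof.
move=> Uz; have [Dt [_ gt gz _]] := chart_coord_gradients Uz.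
have pairing (X X' : 'rV[R[i]]_n) (Y Y' : 'rV[R[i]]_3) :
    row_mx X Y *m torus_bivector (twistor_poisson g h) z *m (row_mx X' Y')^T =
    X *m twistor_poisson g h z.2 *m X'^T.
  rewrite /torus_bivector mul_row_block !mulmx0 !addr0 tr_row_mx mul_row_col.
  by rewrite mul0mx addr0.
have diff_t : twistor_diff (chart_coord (rshift k 0)) z = row_mx 0 Dt.
  by have [_ ->] := twistor_gradient_diff gt.
have diff_z l : exists Y, twistor_diff (chart_coord (lshift 1 l)) z =
    row_mx (row l (coframe_at z.2)) Y.
  by have [D _ /twistor_gradient_diff[_ ->]] := gz l; exists D.
case: (split_ordP i) => i' ->; last first.
  rewrite (ord1 i') diff_t -[twistor_diff _ _ in X in _ *m X]hsubmxK.
  by rewrite pairing !mul0mx mxE mulr0.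
have [Y ->] := diff_z i'.
case: (split_ordP j) => j' ->; last first.
  rewrite (ord1 j') diff_t.
  by rewrite pairing trmx0 mulmx0 mxE mulr0.
have [Y' ->] := diff_z j'; rewrite pairing.
case: (Uz) => _ zb; have [h1 h2 h3 h4] := hopf_relations zb.
rewrite (twistor_poisson_chart g h zb).
have := coframe_bivector Gc hII hJJ hIJ hJI hi h1 h2 h3 h4 PhiI.
rewrite -/(coframe_at z.2); set W := coframe_at z.2.
set X := plane_bivector _ _ _ _ _ _ _ _ _.
move=> <-; rewrite -scalemxAr -scalemxAl [LHS]mxE; congr (_ * _).
by rewrite tr_row -!row_mul !mxE; apply: eq_bigr => l _; rewrite !mxE.
Qed.

Lemma chart_uv_holomorphic g :
  holomorphic_on I J K chart_nbhd (fun z => chart_uv g b z.2).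
Proof.
apply/holomorphic_onP => z [_ /chart_gradients[_ [Du [Dv [_ [gu tu] [gv tv] _]]]]].
case: g; [exists (row_mx 0 Dv)|exists (row_mx 0 Du)]; split=> //.
  by apply: type10_split => //; rewrite mul0mx scaler0.
by apply: type10_split => //; rewrite mul0mx scaler0.
Qed.

End Coframe.

Lemma twistor_poisson_holomorphic g h : holomorphic_section I J K (2 * m + 1)
  (torus_bivector (B := B) (twistor_poisson g h)).
Proof.
split.
  apply: torus_bivector_section => a; first exact: twistor_poisson_skew.
  exact: twistor_poisson_type.
move=> z0; have [Phi [C [PhiI PhiC]]] := coframe_exists hII hJJ hIJ hJI hi hn.
have [b zb] := chart_domT (val z0.2).
exists (chart_nbhd (repr z0.1) b), (chart_coord Phi (repr z0.1) b).
split; first exact: (chart_coord_coordinates PhiI PhiC).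
  by split=> //; exact: cell_interior_center.
move=> i j.
have oU : twistor_open (chart_nbhd (repr z0.1) b) by exact: chart_nbhd_open.
apply: (holomorphic_on_eq oU
  (fun z Uz => esym (chart_coord_pairing PhiI g h i j Uz))).
apply: holomorphic_onM; last exact: holomorphic_on_cst.
by apply: holomorphic_onM; exact: chart_uv_holomorphic.
Qed.

Lemma torus_poisson g h : holomorphic_poisson I J K (2 * m + 1)
  (torus_bivector (B := B) (twistor_poisson g h)).
Proof.
split; first exact: twistor_poisson_holomorphic.
exact: torus_bivector_schouten.
Qed.

Lemma stereographic_relations a (l : R[i]) :
  complexify (val a) = stereographic l ->
  fibre_p true a = l * fibre_p false a /\ fibre_q true a = l * fibre_q false a.
Proof.
move=> E.
have d0 : 1 + `|l| ^+ 2 != 0.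
  by rewrite gt_eqF // ltr_pwDl // exprn_ge0.
have nE : `|l| ^+ 2 = l * conjc l by rewrite sqr_normc.
have E0 := congr1 (fun v : 'cV_3 => v 0 0) E.
have E1 := congr1 (fun v : 'cV_3 => v 1 0) E.
have E2 := congr1 (fun v : 'cV_3 => v 2%:R 0) E.
rewrite /= !mxE (tnth_nth 0) /= in E0.
rewrite /= !mxE (tnth_nth 0) /= in E1.
rewrite /= !mxE (tnth_nth 0) /= in E2.
rewrite /fibre_p /fibre_q E0 E1 E2 nE; rewrite nE in d0.
by split; field: hi.
Qed.

Lemma twistor_poisson_scale a (c : R[i]) :
  fibre_p true a = c * fibre_p false a ->
  fibre_q true a = c * fibre_q false a ->
  twistor_poisson false true a = c *: twistor_poisson false false a /\
  twistor_poisson true true a = c *: twistor_poisson false true a.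
Proof.
rewrite /twistor_poisson; set p := fibre_p false a; set q := fibre_q false a.
move=> -> ->; split.
  by have := plane_bivectorZ Ic Jc Kc Gc 'i%C 1 c p q p q; rewrite !mul1r.
have := plane_bivectorZ Ic Jc Kc Gc 'i%C c 1 p q (c * p) (c * q).
by rewrite !mul1r mulr1.
Qed.

End HyperkahlerTorus.

Theorem theorem4p1 (R : realType) (m : nat) (hm : (0 < m)%N)
    (B G I J K : 'M[R]_(4 * m)) (hB : B \in unitmx)
    (hK : hyperkahler G I J K) :
  let N := (2 * m + 1)%N in
  let P := @twistor_bivector R (4 * m) B I J K G in
  [/\ holomorphic_poisson I J K N P,
      extends_to_poisson I J K N (fun l => l^-1) P &
      extends_to_poisson I J K N (fun l => l) P].
Proof.
move=> N P.
have PE : P = torus_bivector (twistor_poisson G I J K false true).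
  by apply/funext => z; exact: twistor_bivectorE.
have poisson g h := torus_poisson (erefl (4 * m)%N) hB hK g h.
split; first by rewrite PE; exact: poisson.
- exists (torus_bivector (twistor_poisson G I J K false false)).
  split; first exact: poisson.
  move=> z l l0 /stereographic_relations[hp hq]; rewrite PE /torus_bivector.
  have [-> _] := twistor_poisson_scale G I J K hp hq.
  by rewrite scale_block_mx !scaler0 scalerA (mulVf l0) scale1r.
- exists (torus_bivector (twistor_poisson G I J K true true)).
  split; first exact: poisson.
  move=> z l l0 /stereographic_relations[hp hq]; rewrite PE /torus_bivector.
  have [_ ->] := twistor_poisson_scale G I J K hp hq.
  by rewrite scale_block_mx !scaler0.
Qed.
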